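(* For each of the following pairs $(m,w)$, with $\zeta:=e^{2\pi i/m}$, $p_1:=\zeta+\bar\zeta$, $p_5:=\zeta^5+\bar\zeta^5$, let $\Gamma\subset GL(2,\mathbb Z[\zeta])$ be the group of matrices $A$ with $\begin{pmatrix}-1&0\\0&w\end{pmatrix}=A^t\begin{pmatrix}-1&0\\0&w\end{pmatrix}\bar A$: (i) $m=12$, $w=2p_1(p_1+2)$; (ii) $m=10$, $w=2p_1^3$; (iii) $m=18$, $w=p_1(p_1+2)$; (iv) $m=14$, $w=(-p_5)^{-1}$; (v) $m=12$, $w=(p_1+1)^{-1}$. Then the image of $\Gamma$ in $PGL(2,\mathbb C)$ is a Schwarzian triangle group of type (i) $(2,12,12)$, (ii) $(2,10,10)$, (iii) $(2,3,18)$, (iv) $(2,3,14)$, (v) $(2,3,12)$ respectively.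
   Context: $GL(2,\mathbb C)$ acts on $\mathbb P^1\mathbb C$ by linear fractional transformations, giving the image in $PGL(2,\mathbb C)$. A (Schwarzian) triangle group of type $(a,b,c)$ is a group of linear fractional transformations preserving a disc (or half plane), generated by the rotations by angles $2\pi/a$ and $2\pi/b$ around two vertices of a hyperbolic triangle with angles $\pi/a,\pi/b,\pi/c$ (whose product is then a rotation by $2\pi/c$ around the third vertex). *)

(* Defs.v *)
From HB Require Import structures.
From mathcomp Require Import all_boot all_order all_algebra.
From mathcomp Require Import complex.
From mathcomp Require Import reals trigo.
Set Implicit Arguments. Unset Strict Implicit. Unset Printing Implicit Defensive.
Import Order.TTheory GRing.Theory Num.Theory.
Local Open Scope ring_scope.

Section Defs.
Variable R : realType.
Local Notation C := (R[i]).

Definition zeta (m : nat) : C :=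
  Complex (cos (2 * pi / m%:R)) (sin (2 * pi / m%:R)).

Definition cconj (z : C) : C := Complex (complex.Re z) (- complex.Im z).

Definition in_Zzeta (m : nat) (x : C) : Prop :=
  exists (n : nat) (c : 'I_n -> int), x = \sum_(i < n) (c i)%:~R * zeta m ^+ i.

Definition in_GL2_Zzeta (m : nat) (A : 'M[C]_2) : Prop :=
  [/\ A \in unitmx, forall i j, in_Zzeta m (A i j)
    & forall i j, in_Zzeta m (invmx A i j)].

Definition Jform (w : C) : 'M[C]_2 := \matrix_(i < 2, j < 2)
  (if i == j then (if i == 0 then -1 else w) else 0).

Definition Gamma (m : nat) (w : C) (A : 'M[C]_2) : Prop :=
  in_GL2_Zzeta m A /\ Jform w = A^T *m Jform w *m map_mx cconj A.

(* Matrices act on P^1(C) by linear fractional transformations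
   [[a,b],[c,d]] : z |-> (a z + b)/(c z + d); two matrices give the same
   element of PGL(2,C) iff they are proportional. *)
Definition proj_eq (A B : 'M[C]_2) : Prop := exists2 l : C, l != 0 & A = l *: B.

Definition same_PGL_image (S1 S2 : 'M[C]_2 -> Prop) : Prop :=
  (forall A, S1 A -> exists2 B, S2 B & proj_eq A B) /\
  (forall B, S2 B -> exists2 A, S1 A & proj_eq B A).

Inductive gen2 (g1 g2 : 'M[C]_2) : 'M[C]_2 -> Prop :=
  | gen2_1 : gen2 g1 g2 1%:M
  | gen2_m1 X : gen2 g1 g2 X -> gen2 g1 g2 (X *m g1)
  | gen2_i1 X : gen2 g1 g2 X -> gen2 g1 g2 (X *m invmx g1)
  | gen2_m2 X : gen2 g1 g2 X -> gen2 g1 g2 (X *m g2)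
  | gen2_i2 X : gen2 g1 g2 X -> gen2 g1 g2 (X *m invmx g2).

(* Poincare unit disc model.  For p in the disc, phi_p(z) = (z-p)/(1 - conj(p) z)
   is a hyperbolic isometry sending p to 0. *)
Definition in_disc (z : C) : Prop := `|z| < 1.
Definition phi (p z : C) : C := (z - p) / (1 - cconj p * z).
Definition phi_mx (p : C) : 'M[C]_2 := \matrix_(i < 2, j < 2)
  (if i == 0 then (if j == 0 then 1 else - p)
   else (if j == 0 then - cconj p else 1)).

(* hyperbolic angle at vertex p of the triangle p q r equals theta (0 < theta < pi):
   geodesics through 0 are diameters, so after moving p to 0 by the isometry
   phi_p, the angle is the euclidean angle at 0 between phi_p q and phi_p r. *)
Definition hangle_eq (p q r : C) (theta : R) : Prop :=
  let u := phi p q in let v := phi p r in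
  complex.Re (u * cconj v) = complex.Re (`|u| * `|v|) * cos theta.

(* hyperbolic rotation by angle theta about p in the disc, as a matrix:
   phi_p^{-1} o (z |-> e^{i theta} z) o phi_p *)
Definition rot_mx (p : C) (theta : R) : 'M[C]_2 :=
  invmx (phi_mx p) *m
  (\matrix_(i < 2, j < 2) (if i == j then (if i == 0 then Complex (cos theta) (sin theta) else 1) else 0))
  *m phi_mx p.

(* A set S of matrices has image in PGL(2,C) a (Schwarzian) triangle group of
   type (a,b,c): there are a hyperbolic triangle p q r in the unit disc with angles
   pi/a, pi/b, pi/c and a Moebius transformation T (mapping the unit disc to the
   disc / half plane preserved by the group) such that the image of S is the
   T-conjugate of the group generated by the rotations by 2pi/a about p and
   2pi/b about q. *)
Definition triangle_group (S : 'M[C]_2 -> Prop) (a b c : nat) : Prop :=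
  exists (T : 'M[C]_2) (p q r : C),
    [/\ T \in unitmx, [/\ in_disc p, in_disc q & in_disc r],
        [/\ p != q, q != r & p != r],
        [/\ hangle_eq p q r (pi / a%:R), hangle_eq q r p (pi / b%:R)
          & hangle_eq r p q (pi / c%:R)] &
        same_PGL_image S
          (gen2 (invmx T *m rot_mx p (2 * pi / a%:R) *m T)
                (invmx T *m rot_mx q (2 * pi / b%:R) *m T))].

Definition p1 (m : nat) : C := zeta m + cconj (zeta m).
Definition p5 (m : nat) : C := zeta m ^+ 5 + cconj (zeta m ^+ 5).

End Defs.

(* Main.v *)
(* The form diag(-1, w) makes Gamma act on the disc |y/x| < 1/sqrt w, while at
   every other real place of Q(zeta + zeta^-1) the form is definite.  Gamma
   contains the rotation Rot = diag(1, zeta) about the centre 0 and an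
   involution S; with the midpoint of 0 and S 0 they span a triangle whose
   angles are read off from |s|^2 sin^2(pi/m) = cos^2(pi/b), s = S 0 0.

   That Rot and S generate Gamma modulo scalars is a descent on the matrices A
   of Gamma with first column (a, c), where |a|^2 = 1 + w |c|^2.  If A 0 lies
   outside the Dirichlet polygon of 0, i.e. is farther from 0 than its
   vertices, then some S Rot^j A has smaller |a|^2.  The conjugates of |a|^2
   lie in [0, 1], so by integrality of norms |a|^2 drops by at least 1.
   Inside the circumscribed disc |c|^2 is small at every place, and the norm
   of |c|^2 (or of |c|^2 - 1) forces c = 0.  Then A is diagonal, and its
   entries are roots of unity up to a common factor by the same norm
   argument. *)
Require Import Defs.
From HB Require Import structures.
From mathcomp Require Import all_boot all_order all_algebra.
From mathcomp Require Import algC cyclotomic.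
From mathcomp Require Import complex.
From mathcomp Require Import reals trigo.
From mathcomp Require Import ring lra.
Set Implicit Arguments. Unset Strict Implicit. Unset Printing Implicit Defensive.
Import Order.TTheory GRing.Theory Num.Theory.
Local Open Scope ring_scope.

(** * Norms of cyclotomic integers *)

(** Distances stay algebraic. If D is the hyperbolic distance from 0 to A 0, then |a| = cosh(D/2)
    and 1 + 2 w |c|^2 = cosh D. In the right triangle with angles pi/2, pi/b, pi/m the leg from 0
    has hyperbolic cosine cos(pi/b) / sin(pi/m), which must be |s|; the type therefore dictates
    |s|^2, and w |S 1 0|^2 = |s|^2 - 1 must be solved inside Z[zeta]. Elements of Z[zeta] are
    carried by integer polynomials evaluated at zeta; evaluation at zeta^k gives the conjugates. A
    polynomial relation such as |a|^2 = 1 + w |c|^2 then holds at every place, and where w becomes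
    negative it bounds both |a|^2 and |c|^2. Each contradiction compares such bounds with a norm,
    which is a positive integer. *)

Section Cyclotomic_integers.
Variables (K : numFieldType) (n : nat).
Local Notation intp := (map_poly (intr : int -> K)).

(** The product of the ['Phi_d] over d | n is X^n - 1, so z is a root of some ['Phi_d]; then z^d =
    1, which forces d = n. *)
Lemma Cyclotomic_primitive_root (z : K) :
  n.-primitive_root z -> root (intp 'Phi_n) z.
Proof.
move=> pz; have n0 := prim_order_gt0 pz.
have: root (intp (\prod_(d <- divisors n) 'Phi_d)) z.
  rewrite prod_Cyclotomic // rmorphB /= map_polyXn rmorph1 /root !hornerE.
  by rewrite (prim_expr_order pz) subrr.
rewrite rmorph_prod /root horner_prod prodf_seq_eq0 => /hasP [d dn rd].
have [<- //|ne] := eqVneq d n.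
have dvd : (d %| n)%N by rewrite dvdn_divisors.
have d0 := dvdn_gt0 n0 dvd.
have : root (intp (\prod_(e <- divisors d) 'Phi_e)) z.
  rewrite rmorph_prod /root horner_prod prodf_seq_eq0; apply/hasP; exists d => //.
  by rewrite -dvdn_divisors // dvdnn.
rewrite prod_Cyclotomic // rmorphB /= map_polyXn rmorph1 /root !hornerE.
rewrite subr_eq0 -(prim_order_dvd pz) => nd.
by move: ne; rewrite eqn_dvd dvd nd.
Qed.

(* Irreducibility of the cyclotomic polynomial is only available over algC, so
   the common factor of F and 'Phi_n over the rationals is given a root there. *)
Lemma root_primitive_conj (F : {poly int}) (z z' : K) :
    n.-primitive_root z -> n.-primitive_root z' ->
  root (intp F) z -> root (intp F) z'.
Proof.
move=> pz pz' rz; have n0 := prim_order_gt0 pz.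
pose FQ := map_poly (intr : int -> rat) F.
pose PQ := map_poly (intr : int -> rat) 'Phi_n.
have mapQ (L : numFieldType) G :
    map_poly (ratr : rat -> L) (map_poly (intr : int -> rat) G) = map_poly intr G.
  by rewrite -map_poly_comp; apply: eq_map_poly => x /=; rewrite ratr_int.
have PQ0 : PQ != 0.
  exact/monic_neq0/monic_map/Cyclotomic_monic.
set g := gcdp FQ PQ.
have rg : root (map_poly (ratr : rat -> K) g) z.
  by rewrite gcdp_map root_gcd !mapQ rz Cyclotomic_primitive_root.
have g0 : g != 0 by rewrite gcdp_eq0 negb_and PQ0 orbT.
have sg : size (map_poly (ratr : rat -> algC) g) != 1.
  rewrite size_map_poly -(size_map_poly (ratr : rat -> K)) neq_ltn.
  by rewrite (root_size_gt1 _ rg) ?orbT // map_poly_eq0.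
have [y ry] := closed_rootP _ sg.
have py : n.-primitive_root y.
  have [x px] := C_prim_root_exists n0.
  rewrite -(root_cyclotomic px) -(Cintr_Cyclotomic px) -mapQ.
  move: ry; rewrite -!dvdp_XsubCl => /dvdp_trans; apply.
  by rewrite dvdp_map dvdp_gcdr.
have [p [Dp mp dvp]] := minCpolyP y.
have Ep : p = PQ.
  apply: (map_poly_inj (ratr : {rmorphism rat -> algC})).
  by rewrite -Dp (minCpoly_cyclotomic py) -Cintr_Cyclotomic // mapQ.
have : PQ %| FQ.
  have gF : g %| FQ by apply: dvdp_gcdl.
  by apply: dvdp_trans gF; rewrite -Ep -dvp.
rewrite -(dvdp_map (ratr : {rmorphism rat -> K})) !mapQ -dvdp_XsubCl.
by apply: dvdp_trans; rewrite dvdp_XsubCl Cyclotomic_primitive_root.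
Qed.

(* Modulo 'Phi_n the product of the F('X^k) has a remainder taking the same
   value at totient n points, hence that remainder is a constant. *)
Lemma cyclotomic_norm_int (F : {poly int}) (z : K) :
  n.-primitive_root z ->
  exists y : int, \prod_(k <- iota 0 n | coprime k n) (intp F).[z ^+ k] = y%:~R.
Proof.
move=> pz; have n0 := prim_order_gt0 pz.
pose G := \prod_(k <- iota 0 n | coprime k n) (F \Po 'X^k).
have evG x : (intp G).[x] = \prod_(k <- iota 0 n | coprime k n) (intp F).[x ^+ k].
  rewrite /G rmorph_prod horner_prod; apply: eq_bigr => k _.
  by rewrite /= map_comp_poly /= map_polyXn horner_comp hornerXn.
set v := \prod_(k <- _ | _) _.
(* Multiplication by j permutes the residues coprime to n, so passing from z to z^j only reorders
   the factors. *)
have Gj j : coprime j n -> (intp G).[z ^+ j] = v.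
  move=> cj; rewrite evG /v -big_filter -[RHS]big_filter.
  pose f k := ((j * k) %% n)%N.
  rewrite (eq_bigr (fun k => (intp F).[z ^+ f k])); last first.
    by move=> k _; rewrite -exprM /f (prim_expr_mod pz).
  rewrite -(big_map f xpredT (fun k => (intp F).[z ^+ k])); apply: perm_big.
  have fi : {in filter (fun k => coprime k n) (iota 0 n) &, injective f}.
    move=> a b; rewrite !mem_filter !mem_iota /= add0n => /andP[_ la] /andP[_ lb].
    move/eqP; rewrite /f => E; apply/eqP.
    have: a == b %[mod n].
      have cnj : coprime n j by rewrite coprime_sym.
      wlog ab : a b la lb E / (a <= b)%N => [W|].
        case/orP: (leq_total a b) => h; first exact: W.
        by rewrite eq_sym; apply: W; rewrite // eq_sym.
      rewrite eq_sym eqn_mod_dvd // -(Gauss_dvdr _ cnj) mulnBr -eqn_mod_dvd ?leq_mul //.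
      by rewrite eq_sym.
    by rewrite !modn_small.
  set ks := filter _ _ in fi *.
  have us : uniq (map f ks) by rewrite map_inj_in_uniq ?filter_uniq ?iota_uniq.
  apply: (uniq_perm us); first by rewrite filter_uniq ?iota_uniq.
  have sub : {subset map f ks <= ks}.
    move=> x /mapP[k]; rewrite !mem_filter !mem_iota /= add0n => /andP[ck _] ->.
    by rewrite /f ltn_pmod // coprime_modl coprimeMl cj ck.
  by apply: (uniq_min_size us sub _).2; rewrite size_map.
pose r := Pdiv.Ring.rmodp G 'Phi_n.
have rj j : coprime j n -> (intp r).[z ^+ j] = v.
  move=> cj; rewrite -(Gj j cj).
  rewrite [in RHS](Pdiv.RingMonic.rdivp_eq (Cyclotomic_monic n) G).
  rewrite rmorphD rmorphM /= !hornerE.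
  rewrite (_ : (intp 'Phi_n).[_] = 0) ?mulr0 ?add0r //.
  apply/rootP/Cyclotomic_primitive_root.
  by rewrite prim_root_exp_coprime.
have rv : intp r = v%:P.
  apply/eqP; rewrite -subr_eq0; apply/eqP.
  pose rs := [seq z ^+ k | k <- filter (fun k => coprime k n) (iota 0 n)].
  apply: (@roots_geq_poly_eq0 _ _ rs).
  - apply/allP => x /mapP[k]; rewrite mem_filter => /andP[ck _] ->.
    by rewrite /root !hornerE rj // subrr.
  - rewrite map_inj_in_uniq ?filter_uniq ?iota_uniq //.
    move=> a b; rewrite !mem_filter !mem_iota /= add0n => /andP[_ la] /andP[_ lb].
    by move/eqP; rewrite (eq_prim_root_expr pz) !modn_small // => /eqP.
  - rewrite size_map size_filter.
    have -> : count (coprime^~ n) (iota 0 n) = totient n.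
      rewrite totient_count_coprime -sum1_count.
      by rewrite big_mkcond /= /index_iota subn0; apply: eq_bigr => k _;
        rewrite coprime_sym; case: coprime.
    apply: leq_trans (size_polyD _ _) _; rewrite geq_max size_polyN.
    rewrite (leq_trans (size_polyC_leq1 _)) ?totient_gt0 // andbT.
    rewrite (leq_trans (size_poly _ _)) // -ltnS -(size_Cyclotomic n).
    by rewrite Pdiv.Ring.ltn_rmodp monic_neq0 ?Cyclotomic_monic.
exists r`_0; have := congr1 (fun q : {poly K} => q`_0) rv.
by rewrite coef_map coefC eqxx.
Qed.

End Cyclotomic_integers.

Local Open Scope complex_scope.

(** * Squared moduli and complex conjugation *)

Section Complex_numbers.
Variable R : realType.
Local Notation C := (R[i]).

(** Real-valued, whereas the norm of a complex number lies in [C] and is a square root; moduli are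
    compared over [R] through their squares. *)
Definition nsq (z : C) : R := complex.Re z ^+ 2 + complex.Im z ^+ 2.

Lemma cconjE (z : C) : cconj z = conjc z.
Proof. by case: z. Qed.

Lemma map_cconjE m n (A : 'M[C]_(m, n)) : map_mx (@cconj R) A = map_mx conjc A.
Proof. by apply/matrixP => i j; rewrite !mxE cconjE. Qed.

Lemma realCD (x y : R) : (x + y)%:C = x%:C + y%:C :> C.
Proof. exact: rmorphD. Qed.
Lemma realCM (x y : R) : (x * y)%:C = x%:C * y%:C :> C.
Proof. exact: rmorphM. Qed.
Lemma realCN (x : R) : (- x)%:C = - x%:C :> C.
Proof. exact: rmorphN. Qed.
Lemma realC1 : 1%:C = 1 :> C.
Proof. by []. Qed.

Lemma conjcD (x y : C) : conjc (x + y) = conjc x + conjc y.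
Proof. exact: rmorphD. Qed.
Lemma conjcB (x y : C) : conjc (x - y) = conjc x - conjc y.
Proof. exact: rmorphB. Qed.
Lemma conjcN (x : C) : conjc (- x) = - conjc x.
Proof. exact: rmorphN. Qed.
Lemma conjcM (x y : C) : conjc (x * y) = conjc x * conjc y.
Proof. exact: rmorphM. Qed.

Lemma nsqE (z : C) : (nsq z)%:C = z * conjc z.
Proof. by case: z => a b; rewrite /nsq; simpc; congr (_ +i* _); ring. Qed.

Lemma nsqM (x y : C) : nsq (x * y) = nsq x * nsq y.
Proof. by case: x => a b; case: y => c d; rewrite /nsq /=; ring. Qed.

Lemma nsq_ge0 (z : C) : 0 <= nsq z.
Proof. by rewrite addr_ge0 ?sqr_ge0. Qed.

Lemma nsq_eq0 (z : C) : (nsq z == 0) = (z == 0).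
Proof. by rewrite -(inj_eq (@complexI R)) nsqE mulf_eq0 conjc_eq0 orbb. Qed.

Lemma nsq_gt0 (z : C) : (0 < nsq z) = (z != 0).
Proof. by rewrite lt_def nsq_ge0 andbT nsq_eq0. Qed.

Lemma nsq_real (x : R) : nsq x%:C = x ^+ 2.
Proof. by rewrite /nsq /= expr0n addr0. Qed.

Lemma nsqJ (z : C) : nsq (conjc z) = nsq z.
Proof. by case: z => a b; rewrite /nsq /= sqrrN. Qed.

Lemma normC_nsq (z : C) : `|z| = (Num.sqrt (nsq z))%:C.
Proof. by rewrite normc_def. Qed.

End Complex_numbers.
Arguments nsq {R}.

Arguments zeta : simpl never.

(** * Galois conjugates of cyclotomic integers *)

Section Cyclotomic_field.
Variables (R : realType) (m : nat).
Hypothesis m0 : (0 < m)%N.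
Local Notation C := (R[i]).
Local Notation z := (zeta R m).

(** [F] stands for the element F(zeta) of Z[zeta]. For k coprime to m, [ev k F] is its image under
    the automorphism zeta -> zeta^k; [ev_eq0] says that this depends on the element only. *)
Definition ev (k : nat) (F : {poly int}) : C :=
  (map_poly (intr : int -> C) F).[z ^+ k].

Lemma zetaX k : z ^+ k = (cos (2 * pi / m%:R *+ k) +i* sin (2 * pi / m%:R *+ k)).
Proof.
elim: k => [|k IH]; first by rewrite expr0 mulr0n cos0 sin0.
by rewrite exprS IH !(mulrS _ k) cosD sinD /zeta; simpc; rewrite [X in _ +i* X]addrC.
Qed.

Lemma zeta_order : z ^+ m = 1.
Proof.
rewrite zetaX -[X in cos X]mulr_natr -[X in sin X]mulr_natr divfK ?pnatr_eq0 -?lt0n //.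
by rewrite mulr_natl cos2pi sin2pi.
Qed.

Lemma zeta_primitive : m.-primitive_root z.
Proof.
apply/andP; split=> //; apply/forallP => -[i /= im]; rewrite unity_rootE.
have [->|ne] := eqVneq i.+1 m; first by rewrite zeta_order !eqxx.
have {ne}im : (i.+1 < m)%N by rewrite ltn_neqAle ne.
rewrite eqbF_neg; apply/negP => /eqP; rewrite zetaX => -[E _].
(* Half the argument of z^(i+1): it lies strictly between 0 and pi, where the sine is positive,
   while cos 2x = 1 would give sin x = 0. *)
set x : R := pi / m%:R *+ i.+1.
have E2 : 2 * pi / m%:R *+ i.+1 = x *+ 2 by rewrite /x -mulrnA mulnC mulrnA -mulrA mulr_natl.
move: E; rewrite E2 cos_mulr2n => E.
have mR : 0 < m%:R :> R by rewrite ltr0n.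
have : 0 < sin x.
  apply: sin_gt0_pi; rewrite /x -mulr_natr; apply/andP; split.
    by rewrite mulr_gt0 ?divr_gt0 ?pi_gt0.
  by rewrite mulrAC ltr_pdivrMr // ltr_pM2l ?pi_gt0 // ltr_nat.
have := cos2Dsin2 x; nra.
Qed.

Lemma zetaJ : conjc z = z ^+ m.-1.
Proof.
have: z * conjc z = z * z ^+ m.-1.
  rewrite -exprS prednK // zeta_order -nsqE; congr (_ +i* _).
  by rewrite /nsq /= cos2Dsin2.
by apply: mulfI; rewrite (prim_root_eq0 zeta_primitive) -lt0n.
Qed.

Lemma nsq_zetaX k : nsq (z ^+ k) = 1.
Proof. by rewrite zetaX /nsq /= cos2Dsin2. Qed.

Lemma evD k F G : ev k (F + G) = ev k F + ev k G.
Proof. by rewrite /ev rmorphD hornerD. Qed.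
Lemma evN k F : ev k (- F) = - ev k F.
Proof. by rewrite /ev rmorphN hornerN. Qed.
Lemma evM k F G : ev k (F * G) = ev k F * ev k G.
Proof. by rewrite /ev rmorphM hornerM. Qed.
Lemma ev1 k : ev k 1 = 1.
Proof. by rewrite /ev rmorph1 hornerC. Qed.
Lemma evB k F G : ev k (F - G) = ev k F - ev k G.
Proof. by rewrite evD evN. Qed.
Lemma evC k c : ev k c%:P = c%:~R.
Proof. by rewrite /ev map_polyC hornerC. Qed.
Lemma evn k n : ev k n%:R = n%:R.
Proof. by rewrite /ev rmorph_nat hornerMn hornerC. Qed.
Lemma evX k F n : ev k (F ^+ n) = ev k F ^+ n.
Proof. by elim: n => [|n IH]; rewrite ?expr0 ?ev1 // !exprS evM IH. Qed.
Lemma evXn k n : ev k 'X^n = z ^+ (k * n).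
Proof. by rewrite /ev map_polyXn hornerXn exprM. Qed.
Lemma ev_sum k n (F : 'I_n -> {poly int}) : ev k (\sum_i F i) = \sum_i ev k (F i).
Proof. by rewrite /ev rmorph_sum horner_sum. Qed.

(** Complex conjugation on polynomials, since conj zeta = zeta^(m-1). Thus |F(zeta^k)|^2 is the
    value at zeta^k of one polynomial [F * star F] for all k. *)
Definition star (F : {poly int}) : {poly int} := F \Po 'X^(m.-1).

Lemma ev_star k F : ev k (star F) = conjc (ev k F).
Proof.
rewrite /ev /star map_comp_poly /= map_polyXn horner_comp hornerXn.
rewrite -(horner_map conjc) /= -map_poly_comp /=.
rewrite (eq_map_poly (f := conjc \o intr) (g := intr)); last first.
  by move=> c; exact: (rmorph_int (@conjc R)).
have E : conjc (z ^+ k) = z ^+ k ^+ m.-1.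
  by rewrite -exprM mulnC exprM -zetaJ; exact: (rmorphXn (@conjc R)).
by rewrite -E.
Qed.

Lemma ev_eq0 k F : coprime k m -> (ev k F == 0) = (ev 1 F == 0).
Proof.
move=> ck; rewrite /ev expr1.
have pk : m.-primitive_root (z ^+ k) by rewrite prim_root_exp_coprime ?zeta_primitive.
have pz := zeta_primitive.
apply/idP/idP; first exact: (root_primitive_conj pk pz).
exact: (root_primitive_conj pz pk).
Qed.

(** [ks] picks one residue from each pair {k, m - k}. The two factors of a pair are complex
    conjugate, so the norm is a product of squared moduli, hence a positive integer. *)
Lemma cyclotomic_norm_ge1 (ks : seq nat) F :
    perm_eq [seq k <- iota 0 m | coprime k m] (ks ++ map (subn m) ks) ->
  ev 1 F != 0 -> 1 <= \prod_(k <- ks) nsq (ev k F).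
Proof.
move=> pks F0; have [y yE] := cyclotomic_norm_int F zeta_primitive.
have kP k : k \in ks -> (k < m)%N && coprime k m.
  move=> kks; have: k \in [seq k <- iota 0 m | coprime k m].
    by rewrite (perm_mem pks) mem_cat kks.
  by rewrite mem_filter mem_iota add0n => /andP[-> /andP[_ ->]].
have E : (\prod_(k <- ks) nsq (ev k F)) = y%:~R.
  apply: (@complexI R); rewrite rmorph_int -yE -[RHS]big_filter (perm_big _ pks) big_cat big_map /=.
  rewrite rmorph_prod -big_split /= big_seq [RHS]big_seq; apply: eq_bigr => k /kP/andP[km _].
  rewrite nsqE; congr (_ * _). rewrite -ev_star /ev /star map_comp_poly /=.
  rewrite map_polyXn horner_comp hornerXn; congr horner.
  rewrite -exprM; apply/eqP; rewrite (eq_prim_root_expr zeta_primitive).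
  rewrite -(eqn_modDl k) subnKC 1?ltnW // -mulnS prednK // modnn.
  by rewrite modnMl.
have : 0 < \prod_(k <- ks) nsq (ev k F).
  rewrite big_seq; apply: prodr_gt0 => k /kP /andP[_ ck].
  by rewrite nsq_gt0 ev_eq0.
by rewrite E ltr0z -[1](_ : 1%:~R = 1) // ler_int.
Qed.

Lemma in_ZzetaP x : in_Zzeta m x <-> exists F, x = ev 1 F.
Proof.
split=> [[n [c ->]]|[F ->]].
  exists (\sum_i (c i)%:P * 'X^i); rewrite ev_sum; apply: eq_bigr => i _.
  by rewrite evM evC evXn mul1n.
exists (size F), (fun i => F`_i); rewrite /ev expr1.
rewrite (horner_coef_wide _ (size_poly _ _)).
by apply: eq_bigr => i _; rewrite coef_map.
Qed.

End Cyclotomic_field.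

(** * Matrices and projective equality *)

Section Two_by_two_matrices.
Variable K : fieldType.

Definition mx2 (a b c d : K) : 'M[K]_2 := \matrix_(i < 2, j < 2)
  (if i == 0 then (if j == 0 then a else b) else (if j == 0 then c else d)).

Lemma mx2P (A B : 'M[K]_2) :
  A 0 0 = B 0 0 -> A 0 1 = B 0 1 -> A 1 0 = B 1 0 -> A 1 1 = B 1 1 -> A = B.
Proof.
move=> h1 h2 h3 h4; apply/matrixP => i j.
have P (k : 'I_2) : k = 0 \/ k = 1.
  by case: k => [[|[|//]] ?]; [left | right]; apply: val_inj.
by case: (P i) => ->; case: (P j) => ->.
Qed.

Lemma mx2E (A : 'M[K]_2) : A = mx2 (A 0 0) (A 0 1) (A 1 0) (A 1 1).
Proof. by apply: mx2P; rewrite !mxE. Qed.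

Lemma mulmx2E (A B : 'M[K]_2) i j : (A *m B) i j = A i 0 * B 0 j + A i 1 * B 1 j.
Proof.
rewrite mxE !big_ord_recl big_ord0 addr0; congr (A _ _ * B _ _ + A _ _ * B _ _);
  exact: val_inj.
Qed.

Lemma mul_mx2 a b c d a' b' c' d' :
  mx2 a b c d *m mx2 a' b' c' d' =
  mx2 (a * a' + b * c') (a * b' + b * d') (c * a' + d * c') (c * b' + d * d').
Proof. by apply: mx2P; rewrite mulmx2E !mxE. Qed.

Lemma scale_mx2 l a b c d : l *: mx2 a b c d = mx2 (l * a) (l * b) (l * c) (l * d).
Proof. by apply: mx2P; rewrite !mxE. Qed.

Lemma scalar_mx2 l : l%:M = mx2 l 0 0 l.
Proof. by apply: mx2P; rewrite !mxE. Qed.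

Lemma invmx_uniq n (A B : 'M[K]_n) : A *m B = 1%:M -> invmx A = B.
Proof.
move=> AB; have [uA _] := mulmx1_unit AB.
by rewrite -[LHS]mulmx1 -AB mulmxA mulVmx // mul1mx.
Qed.

Lemma mx2_unit a b c d : a * d - b * c != 0 -> mx2 a b c d \in unitmx.
Proof.
move=> D; suff: mx2 a b c d *m ((a * d - b * c)^-1 *: mx2 d (- b) (- c) a) = 1%:M.
  by case/mulmx1_unit.
by rewrite -scalemxAr mul_mx2 scale_mx2 scalar_mx2; apply: mx2P; rewrite !mxE /=; field.
Qed.

Lemma invmx_mx2 a b c d : a * d - b * c != 0 ->
  invmx (mx2 a b c d) = (a * d - b * c)^-1 *: mx2 d (- b) (- c) a.
Proof.
move=> D; apply: invmx_uniq.
by rewrite -scalemxAr mul_mx2 scale_mx2 scalar_mx2; apply: mx2P; rewrite !mxE /=; field.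
Qed.

Lemma invmx_mul n (A B : 'M[K]_n) : A \in unitmx -> B \in unitmx ->
  invmx (A *m B) = invmx B *m invmx A.
Proof.
move=> uA uB; apply: invmx_uniq.
by rewrite mulmxA -(mulmxA A) mulmxV // mulmx1 mulmxV.
Qed.

End Two_by_two_matrices.

Section Projective_equality.
Variable R : realType.
Local Notation C := (R[i]).
Implicit Types A B : 'M[C]_2.

Lemma proj_refl A : proj_eq A A.
Proof. by exists 1; rewrite ?oner_eq0 ?scale1r. Qed.

Lemma proj_sym A B : proj_eq A B -> proj_eq B A.
Proof.
by case=> l l0 ->; exists l^-1; rewrite ?invr_eq0 // scalerA mulVf // scale1r.
Qed.

Lemma proj_trans A B D : proj_eq A B -> proj_eq B D -> proj_eq A D.
Proof.
by case=> l l0 -> [k k0 ->]; exists (l * k); rewrite ?mulf_neq0 // scalerA.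
Qed.

Lemma proj_mul A B A' B' :
  proj_eq A A' -> proj_eq B B' -> proj_eq (A *m B) (A' *m B').
Proof.
case=> l l0 -> [k k0 ->]; exists (l * k); rewrite ?mulf_neq0 //.
by rewrite -scalemxAl -scalemxAr scalerA.
Qed.

Lemma proj_inv A B : B \in unitmx -> proj_eq A B -> proj_eq (invmx A) (invmx B).
Proof.
move=> uB [l l0 ->]; exists l^-1; rewrite ?invr_eq0 //.
by rewrite invmxZ ?unitmxZ ?unitfE.
Qed.

End Projective_equality.

Section Generated_group.
Variables (R : realType) (g h : 'M[R[i]]_2).
Hypotheses (ug : g \in unitmx) (uh : h \in unitmx).

Lemma gen2_mul A B : gen2 g h A -> gen2 g h B -> gen2 g h (A *m B).
Proof.
move=> GA; elim; first by rewrite mulmx1.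
all: by move=> X _; rewrite mulmxA; constructor.
Qed.

Lemma gen2_fst : gen2 g h g.
Proof. by rewrite -[X in gen2 g h X]mul1mx; do !constructor. Qed.

Lemma gen2_snd : gen2 g h h.
Proof. by rewrite -[X in gen2 g h X]mul1mx; apply: gen2_m2; constructor. Qed.

Lemma gen2_unit A : gen2 g h A -> A \in unitmx.
Proof. by elim=> [|X _|X _|X _|X _]; rewrite ?unitmx1 ?unitmx_mul ?unitmx_inv ?ug ?uh ?andbT. Qed.

Lemma gen2_inv A : gen2 g h A -> gen2 g h (invmx A).
Proof.
have I1 : gen2 g h (invmx g).
  by rewrite -[X in gen2 g h X]mul1mx; apply: gen2_i1; constructor.
have I2 : gen2 g h (invmx h).
  by rewrite -[X in gen2 g h X]mul1mx; apply: gen2_i2; constructor.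
elim=> [|X GX IH|X GX IH|X GX IH|X GX IH]; first by rewrite invmx1; constructor.
all: have uX := gen2_unit GX; rewrite invmx_mul ?unitmx_inv //; apply: gen2_mul => //.
- by rewrite invmxK; exact: gen2_fst.
- by rewrite invmxK; exact: gen2_snd.
Qed.

End Generated_group.

(** * The unitary group *)

Section Unitary_group.
Variables (R : realType) (m : nat) (w : R).
Hypotheses (m0 : (0 < m)%N) (w0 : 0 < w).
Local Notation C := (R[i]).
Local Notation z := (zeta R m).
Local Notation G := (Gamma m w%:C).
Local Notation ev := (ev R m).

Lemma in_Zzeta_ev F : in_Zzeta m (ev 1 F).
Proof. by apply/in_ZzetaP; exists F. Qed.

Lemma in_Zzeta_dot (x y x' y' : C) : in_Zzeta m x -> in_Zzeta m y ->
  in_Zzeta m x' -> in_Zzeta m y' -> in_Zzeta m (x * x' + y * y').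
Proof.
move=> /in_ZzetaP[F ->] /in_ZzetaP[H ->] /in_ZzetaP[F' ->] /in_ZzetaP[H' ->].
by rewrite -!evM -evD; exact: in_Zzeta_ev.
Qed.

Lemma in_Zzeta_mul (A B : 'M[C]_2) :
    (forall i j, in_Zzeta m (A i j)) -> (forall i j, in_Zzeta m (B i j)) ->
  forall i j, in_Zzeta m ((A *m B) i j).
Proof. by move=> hA hB i j; rewrite mulmx2E; apply: in_Zzeta_dot. Qed.

Lemma Gamma_unit A : G A -> A \in unitmx.
Proof. by case=> [[]]. Qed.

Lemma Gamma_mul A B : G A -> G B -> G (A *m B).
Proof.
case=> -[uA ZA ZA'] fA [[uB ZB ZB'] fB]; split; first split.
- by rewrite unitmx_mul uA.
- exact: in_Zzeta_mul.
- by rewrite invmx_mul //; exact: in_Zzeta_mul.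
rewrite {1}fB {1}fA trmx_mul !map_cconjE map_mxM.
by rewrite -!map_cconjE !mulmxA.
Qed.

Lemma Gamma_inv A : G A -> G (invmx A).
Proof.
case=> -[uA ZA ZA'] fA; split; first by rewrite /in_GL2_Zzeta unitmx_inv invmxK.
rewrite {2}fA !map_cconjE map_invmx -!mulmxA mulmxV ?map_unitmx // mulmx1.
by rewrite mulmxA -trmx_mul mulmxV // trmx1 mul1mx.
Qed.

(** The form is Hermitian, so the (1,0) entry of the matrix equation is the conjugate of the (0,1)
    entry and three scalar equations remain. *)
Lemma Gamma_formE (A : 'M[C]_2) :
  Jform w%:C = A^T *m Jform w%:C *m map_mx (@cconj R) A <->
  [/\ nsq (A 0 0) = 1 + w * nsq (A 1 0),
      A 0 0 * conjc (A 0 1) = w%:C * A 1 0 * conjc (A 1 1)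
    & w + nsq (A 0 1) = w * nsq (A 1 1)].
Proof.
have E i j : (A^T *m Jform w%:C *m map_mx (@cconj R) A) i j =
    - (A 0 i * conjc (A 0 j)) + w%:C * A 1 i * conjc (A 1 j).
  by rewrite map_cconjE !mulmx2E !mxE /=; ring.
split=> [H|[h1 h2 h3]].
  have H00 := congr1 (fun M : 'M[C]_2 => M 0 0) H.
  have H01 := congr1 (fun M : 'M[C]_2 => M 0 1) H.
  have H11 := congr1 (fun M : 'M[C]_2 => M 1 1) H.
  move: H00 H01 H11; rewrite !E !mxE /= => H00 H01 H11; split.
  - apply: (@complexI R); rewrite (realCD 1) realCM realC1 !nsqE mulrA.
    by apply/eqP; rewrite -subr_eq0 -[1]opprK H00; apply/eqP; ring.
  - by move: H01 => /eqP; rewrite eq_sym addrC subr_eq0 => /eqP.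
  - apply: (@complexI R); rewrite (realCD w) realCM !nsqE mulrA.
    by rewrite {1}H11; ring.
apply: mx2P; rewrite E !mxE /=.
- by rewrite -mulrA -!nsqE h1 (realCD 1) realCM realC1; ring.
- by rewrite h2; ring.
- have h2' := congr1 conjc h2; move: h2'; rewrite !conjcM !conjcK conjc_real => h2'.
  by rewrite mulrC h2'; ring.
- by rewrite -mulrA -!nsqE -realCM -h3 (realCD w); ring.
Qed.

Lemma Gamma_col A : G A -> nsq (A 0 0) = 1 + w * nsq (A 1 0).
Proof. by case=> _ /Gamma_formE[]. Qed.

(** With c = 0 the entry [A 0 0] has modulus 1, so orthogonality of the columns kills [A 0 1]. *)
Lemma Gamma_diag A : G A -> A 1 0 = 0 ->
  exists u v, [/\ A = mx2 u 0 0 v, nsq u = 1, nsq v = 1 , in_Zzeta m u & in_Zzeta m v].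
Proof.
case=> -[uA ZA ZA'] /Gamma_formE[h1 h2 h3] A10.
move: h1 h2; rewrite A10 !(mulr0, mul0r) => h1 /eqP h2.
have n1 : nsq (A 0 0) = 1 by rewrite h1 /nsq /=; ring.
have A01 : A 0 1 = 0.
  move: h2; rewrite mulf_eq0 conjc_eq0 -nsq_eq0 n1 oner_eq0 /= => /eqP //.
exists (A 0 0), (A 1 1); split=> //; first by rewrite {1}(mx2E A) A10 A01.
move: h3; rewrite A01 (nsq_real 0) expr0n addr0 -{1}[w]mulr1.
by move/(mulfI (lt0r_neq0 w0)).
Qed.

Lemma Gamma_intro (A B : 'M[C]_2) :
    A *m B = 1%:M -> (forall i j, in_Zzeta m (A i j)) ->
    (forall i j, in_Zzeta m (B i j)) ->
    nsq (A 0 0) = 1 + w * nsq (A 1 0) ->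
    A 0 0 * conjc (A 0 1) = w%:C * A 1 0 * conjc (A 1 1) ->
    w + nsq (A 0 1) = w * nsq (A 1 1) ->
  G A.
Proof.
move=> AB ZA ZB h1 h2 h3; split; last exact/Gamma_formE.
by split=> //; [case: (mulmx1_unit AB) | rewrite (invmx_uniq AB)].
Qed.

End Unitary_group.

(** * Inequalities for the descent *)

Lemma prodr_le1 (R : realDomainType) (I : eqType) (r : seq I) (F : I -> R) :
  (forall i, i \in r -> 0 <= F i <= 1) -> \prod_(i <- r) F i <= 1.
Proof.
move=> H; have: 0 <= \prod_(i <- r) F i <= 1.
  rewrite big_seq; elim/big_rec: _ => [|i x /H /andP[F0 F1] /andP[x0 x1]].
    by rewrite ler01 lexx.
  by rewrite mulr_ge0 //= mulr_ile1.
by case/andP.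
Qed.

Lemma prodr_le_exp (R : realDomainType) (I : eqType) (r : seq I) (F : I -> R) c :
  (forall i, i \in r -> 0 <= F i <= c) -> \prod_(i <- r) F i <= c ^+ size r.
Proof.
elim: r => [|x r IH] H; first by rewrite big_nil.
have /andP[x0 xc] := H x (mem_head _ _).
have H' i : i \in r -> 0 <= F i <= c by move=> ir; apply: H; rewrite inE ir orbT.
rewrite big_cons /= exprS ler_pM ?IH //.
by rewrite big_seq prodr_ge0 // => i /H' /andP[].
Qed.

Lemma nsqD (R : realType) (x y : R[i]) :
  nsq (x + y) = nsq x + nsq y + 2 * complex.Re (conjc x * y).
Proof. by case: x => a b; case: y => c d; rewrite /nsq /=; ring. Qed.

(** [B] and [g] will be w |c|^2 for S and for A, and [c2] will be cos^2(pi/m). The conclusion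
    amounts to (1 + B)(1 + g) + B g - 2 X < 1 + g. Since 4 g (1 + g) = (1 + 2 g)^2 - 1, its
    negation, once squared, contradicts the last hypothesis. *)
Lemma dist_decreases (R : realFieldType) (c2 B g X : R) : 0 <= X -> 0 < B -> 0 < g ->
    c2 * ((1 + B) * (1 + g) * (B * g)) <= X ^+ 2 ->
    c2 * (1 + B) < (1 + 2 * g) ^+ 2 * (c2 * (1 + B) - B) ->
  B * (1 + 2 * g) < 2 * X.
Proof.
move=> X0 B0 g0 X2 big; rewrite ltNge; apply/negP => le.
have X4 : (2 * X) ^+ 2 <= (B * (1 + 2 * g)) ^+ 2.
  have r0 : 0 <= B * (1 + 2 * g) by rewrite mulr_ge0; lra.
  by rewrite ler_sqr // nnegrE; lra.
have : B * (c2 * (1 + B)) < B * ((1 + 2 * g) ^+ 2 * (c2 * (1 + B) - B)).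
  by rewrite ltr_pM2l.
by move: X4 X2; clear; lra.
Qed.

(** * Descent *)

Section Sector.
Variables (R : realType) (m : nat).
Hypothesis m2 : (2 < m)%N.
Local Notation C := (R[i]).
Local Notation z := (zeta R m).
Local Notation co := (cos (pi / m%:R) : R).
Local Notation si := (sin (pi / m%:R) : R).

Lemma pi_div_lt_pihalf : 0 < (pi : R) / m%:R < pi / 2.
Proof.
have p0 := pi_gt0 R; have m0 : 0 < m%:R :> R by rewrite ltr0n; exact: ltn_trans m2.
by rewrite divr_gt0 //= ltr_pM2l // ltf_pV2 ?posrE // ltr_nat.
Qed.

Lemma cos_pi_div_gt0 : 0 < co.
Proof. by have /andP[h1 h2] := pi_div_lt_pihalf; apply: cos_gt0_pihalf; apply/andP; split; lra. Qed.

Lemma sin_pi_div_gt0 : 0 < si.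
Proof. exact: sin_gt0_pihalf pi_div_lt_pihalf. Qed.

Lemma zetaE : z = (co ^+ 2 - si ^+ 2) +i* (2 * co * si).
Proof.
have E : 2 * pi / m%:R = pi / m%:R *+ 2 :> R by rewrite -mulrA mulr_natl.
by rewrite /zeta E cos_mulr2n sin_mulr2n sin2cos2; congr (_ +i* _); ring.
Qed.

(* Among the z ^+ j * y take one of maximal real part: comparing it with both
   neighbours bounds its argument. *)
Lemma sector (y : C) : exists j,
  0 <= complex.Re (z ^+ j * y) /\ co ^+ 2 * nsq y <= complex.Re (z ^+ j * y) ^+ 2.
Proof.
have m0 : (0 < m)%N by exact: ltn_trans m2.
pose f (j : 'I_m) := complex.Re (z ^+ j * y).
have [j _ jmax] := @Order.TotalTheory.arg_maxP _ _ _ (Ordinal m0) xpredT f isT.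
exists j; set x := z ^+ j * y.
have modj k : complex.Re (z ^+ k * y) <= complex.Re x.
  rewrite -(prim_expr_mod (zeta_primitive R m0)).
  exact: (jmax (Ordinal (ltn_pmod k m0))).
have n1 : complex.Re (z * x) <= complex.Re x by rewrite /x mulrA -exprS modj.
have n2 : complex.Re (conjc z * x) <= complex.Re x.
  by rewrite zetaJ // /x mulrA -exprD modj.
have <- : nsq x = nsq y by rewrite nsqM nsq_zetaX mul1r.
move: n1 n2; rewrite zetaE; case: x {modj} => a b; rewrite /nsq /=.
have c0 := cos_pi_div_gt0; have s0 := sin_pi_div_gt0.
have cs := cos2Dsin2 (pi / m%:R : R).
set c := cos _ in c0 cs *; set s := sin _ in s0 cs *.
have -> : c ^+ 2 - s ^+ 2 = 1 - 2 * s ^+ 2 by lra.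
move=> n1 n2.
have {}n1 : - (b * c) <= a * s.
  have : 0 <= (2 * s) * (a * s + b * c) by lra.
  by rewrite pmulr_rge0 ?mulr_gt0 //; lra.
have {}n2 : b * c <= a * s.
  have : 0 <= (2 * s) * (a * s - b * c) by lra.
  by rewrite pmulr_rge0 ?mulr_gt0 //; lra.
have a0 : 0 <= a.
  have : 0 <= s * a by lra.
  by rewrite pmulr_rge0.
split=> //.
have : (b * c) ^+ 2 <= (a * s) ^+ 2 by nra.
rewrite !exprMn (_ : s ^+ 2 = 1 - c ^+ 2); last by lra.
by lra.
Qed.

End Sector.

Section Descent.
Variables (R : realType) (m : nat) (ks : seq nat).
Local Notation C := (R[i]).
Local Notation z := (zeta R m).
Local Notation ev := (ev R m).
Local Notation co := (cos (pi / m%:R) : R).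
Hypothesis m2 : (2 < m)%N.
Hypothesis pks : perm_eq [seq k <- iota 0 m | coprime k m]
                         ((1%N :: ks) ++ map (subn m) (1%N :: ks)).
Let m0 : (0 < m)%N := ltn_trans (isT : 0 < 2)%N m2.

Lemma conj_coprime k : k \in ks -> coprime k m.
Proof.
move=> kks; have: k \in [seq k <- iota 0 m | coprime k m].
  by rewrite (perm_mem pks) mem_cat inE kks orbT.
by rewrite mem_filter => /andP[].
Qed.

Lemma norm_ge1 F : ev 1 F != 0 ->
  1 <= nsq (ev 1 F) * \prod_(k <- ks) nsq (ev k F).
Proof. by move=> F0; have := cyclotomic_norm_ge1 m0 pks F0; rewrite big_cons. Qed.

Lemma ev_transfer F H k : k \in ks -> ev 1 F = ev 1 H -> ev k F = ev k H.
Proof.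
move=> kks E; apply/eqP; rewrite -subr_eq0 -evB (ev_eq0 R m0) ?conj_coprime //.
by rewrite evB E subrr.
Qed.

Lemma nsq_ev k F : (nsq (ev k F))%:C = ev k (F * star m F).
Proof. by rewrite nsqE evM ev_star. Qed.

Hypothesis small_chord : (2 - 2 * co) * 4 ^+ size ks < 1.

(** A case of Kronecker's theorem. All conjugates of u have modulus 1. Turned into the sector |arg|
    <= pi/m, u satisfies |u - 1|^2 <= 2 - 2 cos(pi/m); the other conjugates of u - 1 have squared
    modulus at most 4, so [small_chord] puts the norm of u - 1 below 1. *)
Lemma unit_root_of_unity (u : C) : in_Zzeta m u -> nsq u = 1 ->
  exists j, z ^+ j * u = 1.
Proof.
move=> /in_ZzetaP[F uF] u1; have [j [re0 re1]] := sector m2 u; exists j.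
pose H : {poly int} := 'X^j * F.
have HE : ev 1 H = z ^+ j * u by rewrite evM evXn mul1n uF.
have nk k : k \in ks -> nsq (ev k H) = 1.
  move=> kks; apply: (@complexI R).
  rewrite nsq_ev -[RHS](ev1 R m k); apply: ev_transfer => //.
  by rewrite -nsq_ev HE nsqM nsq_zetaX u1 mul1r ev1.
have n1 : nsq (ev 1 H) = 1 by rewrite HE nsqM nsq_zetaX mul1r.
have chord x : nsq x = 1 -> nsq (x - 1) = 2 - 2 * complex.Re x.
  by case: x => a b; rewrite /nsq /= => E; lra.
apply/eqP; rewrite -subr_eq0 -HE -(ev1 R m 1) -evB; apply: contraT => /norm_ge1.
rewrite evB ev1 chord // HE leNgt => /negP[].
apply: le_lt_trans small_chord; apply: ler_pM.
- have : complex.Re (z ^+ j * u) ^+ 2 <= 1.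
    by rewrite -n1 HE /nsq lerDl sqr_ge0.
  rewrite -[1](expr1n _ 2) ler_sqr ?nnegrE //; lra.
- by rewrite prodr_ge0 // => k _; exact: nsq_ge0.
- have c0 := cos_pi_div_gt0 R m2.
  move: re1; rewrite u1 mulr1 ler_sqr ?nnegrE ?(ltW c0) //; lra.
apply: prodr_le_exp => k kks; rewrite nsq_ge0 /= evB ev1 chord ?nk //.
have := nk k kks; case: (ev k H) => a b; rewrite /nsq /= => E.
have : (-a) ^+ 2 <= 1 ^+ 2 by rewrite sqrrN expr1n -E lerDl sqr_ge0.
have [a0|a0] := lerP a 0; last by lra.
by rewrite ler_sqr ?nnegrE //; lra.
Qed.

Variables (w : R) (wk : nat -> R) (v : nat) (U : {poly int}).
Local Notation G := (Gamma m w%:C).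
Hypothesis w0 : 0 < w.
Hypothesis v0 : (0 < v)%N.
(* w = U(zeta) / v, with conjugates wk k = U(zeta^k) / v. *)
Hypothesis U1 : ev 1 U = (v%:R * w)%:C.
Hypothesis Uk : forall k, k \in ks -> ev k U = (v%:R * wk k)%:C.
Hypothesis wk_lt0 : forall k, k \in ks -> wk k < 0.

Lemma Gamma_col_conj A : G A -> exists Fa Fc,
  [/\ A 0 0 = ev 1 Fa, A 1 0 = ev 1 Fc
    & forall k, k \in ks -> nsq (ev k Fa) = 1 + wk k * nsq (ev k Fc)].
Proof.
move=> GA; have [[_ ZA _] _] := GA.
have /in_ZzetaP[Fa Ea] := ZA 0 0; have /in_ZzetaP[Fc Ec] := ZA 1 0.
exists Fa, Fc; split=> // k kks.
have vR : v%:R != 0 :> R by rewrite pnatr_eq0 -lt0n.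
(* [w] may fail to be an algebraic integer; multiplied by [v], the relation is one between integer
   polynomials and passes to the conjugates. *)
apply: (mulfI vR); apply: (@complexI R).
rewrite (mulrDr _ 1) mulrA mulr1 (realCD v%:R) !(realCM v%:R) (realCM (v%:R * wk k)) -Uk // !nsq_ev.
have -> : (v%:R : R)%:C = v%:R :> C by exact: rmorph_nat.
rewrite -(evn R m k) -!evM -evD; apply: ev_transfer => //.
rewrite evD !evM U1 evn !ev_star // -!nsqE -Ea -Ec (Gamma_col GA).
by rewrite (realCD 1) (realCM w) realCM rmorph_nat realC1; ring.
Qed.

Lemma Gamma_gap A B : G A -> G B -> nsq (B 0 0) < nsq (A 0 0) ->
  nsq (B 0 0) + 1 <= nsq (A 0 0).
Proof.
move=> GA GB lt; have [F [F' [EF _ Fk]]] := Gamma_col_conj GA.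
have [H [H' [EH _ Hk]]] := Gamma_col_conj GB.
pose D := F * star m F - H * star m H.
have DE k : ev k D = (nsq (ev k F) - nsq (ev k H))%:C.
  by rewrite evB -!nsq_ev (realCD (nsq _)) realCN.
have D1 : ev 1 D = (nsq (A 0 0) - nsq (B 0 0))%:C by rewrite DE EF EH.
have D0 : ev 1 D != 0.
  by rewrite D1 -nsq_eq0 nsq_real sqrf_eq0 subr_eq0 gt_eqF.
have b01 k K K' : k \in ks -> nsq (ev k K) = 1 + wk k * nsq (ev k K') ->
    0 <= nsq (ev k K) <= 1.
  move=> /wk_lt0 wk0 E; rewrite nsq_ge0 E /= gerDl.
  by rewrite nmulr_rle0 // nsq_ge0.
have le1 : \prod_(k <- ks) nsq (ev k D) <= 1.
  apply: prodr_le1 => k kks; rewrite nsq_ge0 DE nsq_real /=.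
  have := b01 _ _ _ kks (Fk k kks); have := b01 _ _ _ kks (Hk k kks).
  by move: (nsq _) (nsq _) => x y /andP[? ?] /andP[? ?]; nra.
have := norm_ge1 D0; rewrite D1 nsq_real.
have P0 : 0 <= \prod_(k <- ks) nsq (ev k D).
  by rewrite prodr_ge0 // => k _; exact: nsq_ge0.
move: (\prod_(k <- ks) _) P0 le1 => P P0 P1; move: (nsq _) (nsq _) lt => x y xy h.
have : 1 ^+ 2 <= (x - y) ^+ 2 by rewrite expr1n (le_trans h) // ler_piMr // sqr_ge0.
by rewrite ler_sqr ?nnegrE ?subr_ge0 ?(ltW xy) //; lra.
Qed.

Variables (S : 'M[C]_2) (sb2 : R).
Hypothesis GS : G S.
Hypothesis S10 : S 1 0 != 0.
Hypothesis S01 : nsq (S 0 1) = w ^+ 2 * nsq (S 1 0).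
Hypothesis circumradius : co ^+ 2 * nsq (S 0 0) - w * nsq (S 1 0) = sb2.
(** 1 + 2 w |c|^2 is cosh of the distance from 0 to A 0, and co^2 |s|^2 / sb2 is cosh^2 of the
    circumradius of the polygon. The second premise holds for an entry c because 1 + wk |c|^2 is
    then the conjugate of |a|^2. *)
Hypothesis no_small : forall F, ev 1 F != 0 ->
  (forall k, k \in ks -> 0 <= 1 + wk k * nsq (ev k F)) ->
  (1 + 2 * w * nsq (ev 1 F)) ^+ 2 * sb2 <= co ^+ 2 * nsq (S 0 0) -> False.

Let Rot : 'M[C]_2 := mx2 1 0 0 z.

Lemma RotX j : Rot ^+ j = mx2 1 0 0 (z ^+ j).
Proof.
elim: j => [|j IH]; first by rewrite !expr0 -scalar_mx2.
by rewrite exprS IH [LHS]mul_mx2 !(mulr0, mul0r, addr0, add0r, mulr1) exprS.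
Qed.

Lemma Gamma_Rot : G Rot.
Proof.
have zc : z * conjc z = 1 by rewrite -nsqE -[z]expr1 nsq_zetaX.
have E n : z ^+ n = ev 1 'X^n by rewrite evXn mul1n.
have Z0 : in_Zzeta m (0 : C).
  by apply/in_ZzetaP; exists 0; rewrite /ev rmorph0 horner0.
have Z1 : in_Zzeta m (1 : C) by apply/in_ZzetaP; exists 1; rewrite ev1.
apply: (Gamma_intro (B := mx2 1 0 0 (conjc z))).
- by rewrite mul_mx2 scalar_mx2 zc !(mulr0, mul0r, addr0, add0r, mulr1).
- move=> i j; rewrite mxE; case: ifP => _; case: ifP => _ //.
  by rewrite -[z]expr1 E; exact: in_Zzeta_ev.
- move=> i j; rewrite mxE; case: ifP => _; case: ifP => _ //.
  by rewrite zetaJ // E; exact: in_Zzeta_ev.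
- by rewrite !mxE /= !nsq_real; ring.
- by rewrite !mxE /= oppr0 !(mulr0, mul0r).
- by rewrite !mxE /= -[z]expr1 nsq_zetaX nsq_real; ring.
Qed.

Lemma descent_step A : G A -> A 1 0 != 0 ->
  exists j, nsq ((S *m Rot ^+ j *m A) 0 0) < nsq (A 0 0).
Proof.
move=> GA A10; have [Fa [Fc [Ea Ec Hk]]] := Gamma_col_conj GA.
have colA := Gamma_col GA; have colS := Gamma_col GS.
have tn0 := S10; have nS01 := S01; have cr := circumradius; have ns := no_small.
set a := A 0 0 in colA Ea *; set c := A 1 0 in A10 colA Ec *.
set s := S 0 0 in colS cr ns *; set t := S 1 0 in tn0 nS01 colS cr.
(* -2 X is the cross term of |s a + S01 z^j c|^2, so the rotation is chosen to make that term
   strongly negative. *)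
have [j [X0 X2]] := sector m2 (- (conjc (s * a) * S 0 1 * c)); exists j.
set X := complex.Re _ in X0 X2.
have -> : (S *m Rot ^+ j *m A) 0 0 = s * a + S 0 1 * z ^+ j * c.
  by rewrite RotX !mulmx2E !mxE /= -/s -/a -/c; ring.
have -> : nsq (s * a + S 0 1 * z ^+ j * c)
        = nsq s * nsq a + nsq (S 0 1) * nsq c - 2 * X.
  rewrite nsqD !nsqM nsq_zetaX mulr1 /X -mulrN -raddfN /=; congr (_ + _ * _).
  congr complex.Re; ring.
have {}X2 : co ^+ 2 * (nsq s * nsq a * (nsq (S 0 1) * nsq c)) <= X ^+ 2.
  apply: le_trans X2; rewrite le_eqVlt; apply/orP; left; apply/eqP; congr (_ * _).
  have nsqN x : nsq (- x) = nsq x :> R by case: x => ? ?; rewrite /nsq /= !sqrrN.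
  by rewrite nsqN !nsqM nsqJ nsqM; ring.
have big : co ^+ 2 * nsq s < (1 + 2 * w * nsq c) ^+ 2 * sb2.
  rewrite ltNge; apply/negP => le; apply: (ns Fc); rewrite -?Ec //.
  by move=> k kks; rewrite -Hk // nsq_ge0.
have N0 : 0 < nsq c by rewrite nsq_gt0.
have T0 : 0 < nsq t by rewrite nsq_gt0.
move: X2; rewrite nS01 colA colS.
set g := w * nsq c; set B := w * nsq t.
have g0 : 0 < g by rewrite mulr_gt0. 
have B0 : 0 < B by rewrite mulr_gt0. 
have E : w ^+ 2 * nsq t * nsq c = B * g by rewrite /B /g; ring.
rewrite E => X2.
have {}big : co ^+ 2 * (1 + B) < (1 + 2 * g) ^+ 2 * (co ^+ 2 * (1 + B) - B).
  by rewrite -colS cr /g mulrA.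
rewrite ltrBlDr.
by have := dist_decreases X0 B0 g0 X2 big; lra.
Qed.

(** [P] will be membership, up to a scalar, in the group generated by the two rotations; its clause
    on [l%:M] expresses generation modulo scalars. *)
Theorem Gamma_generated (P : 'M[C]_2 -> Prop) :
    (forall A B, P A -> P B -> P (A *m B)) ->
    (forall A, A \in unitmx -> P A -> P (invmx A)) ->
    (forall l : C, l != 0 -> P l%:M) -> P Rot -> P S ->
  forall A, G A -> P A.
Proof.
move=> Pmul Pinv Pscal PR PS.
have PRX j : P (Rot ^+ j).
  elim: j => [|j IH]; first by rewrite expr0; apply: Pscal; exact: oner_neq0.
  by rewrite exprS; exact: Pmul.
have GRX j : G (Rot ^+ j).
  elim: j => [|j IH]; last by rewrite exprS; exact: Gamma_mul Gamma_Rot IH.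
  by have := Gamma_mul (Gamma_inv Gamma_Rot) Gamma_Rot; rewrite mulVmx ?(Gamma_unit Gamma_Rot).
have cancel M A : G M -> P M -> P (M *m A) -> P A.
  move=> GM PM PMA; have uM := Gamma_unit GM.
  by rewrite -[A]mul1mx -(mulVmx uM) -mulmxA; apply: Pmul => //; exact: Pinv.
(* Induction on an integer bound for |a|^2: by [Gamma_gap] one descent step lowers |a|^2 by at least
   1. *)
have main n A : G A -> nsq (A 0 0) < n%:R -> P A.
  elim: n A => [|n IH] A GA lt; first by have := nsq_ge0 (A 0 0); lra.
  have [A10|A10] := eqVneq (A 1 0) 0.
    have [u [v' [AE nu nv Zu Zv]]] := Gamma_diag w0 GA A10.
    (* This is v' / u, as |u| = 1. Once a power of Rot has cancelled this root of unity, the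
       diagonal matrix becomes the scalar u. *)
    have Ze : in_Zzeta m (v' * conjc u).
      move: Zu Zv => /in_ZzetaP[F ->] /in_ZzetaP[H ->].
      by rewrite -ev_star // -evM; exact: in_Zzeta_ev.
    have ne : nsq (v' * conjc u) = 1 by rewrite nsqM nsqJ nu nv mulr1.
    have [j ej] := unit_root_of_unity Ze ne.
    apply: (cancel (Rot ^+ j)) => //.
    have -> : Rot ^+ j *m A = u%:M; last by apply: Pscal; rewrite -nsq_eq0 nu oner_eq0.
    rewrite RotX AE mul_mx2 scalar_mx2 !(mulr0, mul0r, addr0, add0r, mulr1, mul1r).
    congr mx2.
    have {}nu : u * conjc u = 1 by rewrite -nsqE nu.
    by rewrite -[LHS]mulr1 -nu mulrCA -mulrA ej mulr1.
  have [j lt'] := descent_step GA A10.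
  have GSR : G (S *m Rot ^+ j) by exact: Gamma_mul.
  apply: (cancel (S *m Rot ^+ j)) => //; first exact: Pmul.
  apply: IH; first exact: Gamma_mul.
  have := Gamma_gap GA (Gamma_mul GSR GA) lt'.
  by move: lt; rewrite -(natr1 n); lra.
move=> A GA; apply: (main (Num.bound (nsq (A 0 0)))) => //.
by apply: le_lt_trans (archi_boundP (nsq_ge0 _)).
Qed.

End Descent.

(** * Hyperbolic triangles *)

Section Hyperbolic_geometry.
Variable R : realType.
Local Notation C := (R[i]).

Lemma in_discE (x : C) : in_disc x <-> nsq x < 1.
Proof.
rewrite /in_disc normC_nsq -[1 in X in X <-> _]/(1%:C) ltcR.
have := sqr_sqrtr (nsq_ge0 x); have := sqrtr_ge0 (nsq x).
by move: (Num.sqrt _) => y y0 <-; rewrite expr_lt1.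
Qed.

(** [Y] is the product of the two moduli, recognised by its square; a rational expression for it
    removes all square roots from the angle condition. *)
Lemma hangleI (p q r : C) th (Y : R) : 0 <= Y ->
    Y ^+ 2 = nsq (phi p q) * nsq (phi p r) ->
    complex.Re (phi p q * conjc (phi p r)) = Y * cos th ->
  hangle_eq p q r th.
Proof.
move=> Y0 Y2 H.
change (complex.Re (phi p q * cconj (phi p r))
  = complex.Re (`|phi p q| * `|phi p r|) * cos th).
rewrite cconjE H !normC_nsq -realCM.
by rewrite -sqrtrM ?nsq_ge0 // -Y2 sqrtr_sqr ger0_norm.
Qed.

Lemma Re_div (x y : C) : complex.Re (x / y) = complex.Re (x * conjc y) / nsq y.
Proof. by case: x => a b; case: y => c d; rewrite /nsq /=; ring. Qed.

Lemma Re_mulJ (x y : C) : complex.Re (x * conjc y) = complex.Re (y * conjc x).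
Proof. by case: x => a b; case: y => c d /=; ring. Qed.

Lemma nsq_div (x y : C) : nsq (x / y) = nsq x / nsq y.
Proof.
have [->|y0] := eqVneq y 0.
  by rewrite invr0 mulr0 (nsq_real 0) expr0n invr0 mulr0.
have n0 : nsq y != 0 by rewrite nsq_eq0.
by apply: (mulIf n0); rewrite divfK // -nsqM divfK.
Qed.

Lemma phi0 (x : C) : phi 0 x = x.
Proof. by rewrite /phi cconjE conjc0 mul0r !subr0 divr1. Qed.

Lemma phi_at0 (x : C) : phi x 0 = - x.
Proof. by rewrite /phi mulr0 subr0 divr1 sub0r. Qed.

Lemma phi_mx2 (p : C) : phi_mx p = mx2 1 (- p) (- conjc p) 1.
Proof. by apply: mx2P; rewrite !mxE /= ?cconjE. Qed.

Lemma rot_mx_proj (p : C) th : nsq p < 1 ->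
  let l := cos th +i* sin th in
  proj_eq (rot_mx p th) (mx2 (l - (nsq p)%:C) (p * (1 - l))
                             (conjc p * (l - 1)) (1 - l * (nsq p)%:C)).
Proof.
move=> p1 l.
have D : 1 * 1 - (- p) * (- conjc p) != 0.
  rewrite mulr1 mulrNN -nsqE -[1]/(1%:C) -rmorphB fmorph_eq0 subr_eq0.
  by rewrite gt_eqF.
exists (1 * 1 - (- p) * (- conjc p))^-1; first by rewrite invr_eq0.
rewrite /rot_mx phi_mx2 invmx_mx2 //.
have -> : \matrix_(i, j) (if i == j then if i == 0 then cos th +i* sin th else 1 else 0)
   = mx2 l 0 0 1 by apply: mx2P; rewrite !mxE.
rewrite -!scalemxAl !mul_mx2; congr (_ *: mx2 _ _ _ _); rewrite ?nsqE; ring.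
Qed.

(** * The right triangle with vertices of orders 2, b and m *)

Section Triangle.
Variables (m b : nat) (al be : R).
Hypotheses (m2 : (2 < m)%N) (b2 : (2 < b)%N).
Local Notation z := (zeta R m).
Local Notation co := (cos (pi / m%:R) : R).
Local Notation si := (sin (pi / m%:R) : R).
Local Notation cb := (cos (pi / b%:R) : R).
Local Notation sb := (sin (pi / b%:R) : R).
Hypotheses (al0 : 0 < al) (be0 : 0 < be) (albe : al ^+ 2 = 1 + be ^+ 2).
(** The relation cosh d sin(pi/m) = cos(pi/b) of a hyperbolic right triangle, d being the leg
    opposite the angle pi/b. *)
Hypothesis angle : al * si = cb.

(** tanh(d/2), the Euclidean modulus of a point at hyperbolic distance d from 0. *)
Definition vert2 : R := (al - 1) / be.
(** tanh(h/2) = (cosh h - 1) / sinh h for the hypotenuse h, with cosh h = al co / sb and sinh h = be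
    / sb. *)
Definition radius : R := (al * co - sb) / be.
Definition vertb : C := (radius * co) +i* (radius * si).
Local Notation p := vert2.
Local Notation rho := radius.
Local Notation q := vertb.

Let si0 : 0 < si := sin_pi_div_gt0 R m2.
Let co0 : 0 < co := cos_pi_div_gt0 R m2.
Let sb0 : 0 < sb := sin_pi_div_gt0 R b2.
Let cs : co ^+ 2 + si ^+ 2 = 1 := cos2Dsin2 _.
Let csb : cb ^+ 2 + sb ^+ 2 = 1 := cos2Dsin2 _.

(** This is cosh^2 h - sinh^2 h = 1 multiplied by sb^2. *)
Lemma circumradius_identity : (al * co) ^+ 2 - sb ^+ 2 = be ^+ 2.
Proof.
have : (al * si) ^+ 2 = cb ^+ 2 by rewrite angle.
by move: cs csb albe; rewrite !exprMn => h1 h2 h3 h4; rewrite (_ : si ^+ 2 = 1 - co ^+ 2) in h4; lra.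
Qed.

Lemma al_gt1 : 1 < al.
Proof.
have := albe; have := al0; have := exprn_gt0 2 be0 => h1 h2 h3.
by rewrite -(ltr_pXn2r (n := 2)) ?nnegrE ?ler01 ?ltW // expr1n; lra.
Qed.

Lemma alco_gt_sb : sb < al * co.
Proof.
have h := exprn_gt0 2 be0.
have ac0 : 0 < al * co by rewrite mulr_gt0.
rewrite -(ltr_pXn2r (n := 2)) ?nnegrE ?(ltW sb0) ?(ltW ac0) //.
by have := circumradius_identity; lra.
Qed.

Lemma vert2_gt0 : 0 < p.
Proof. by rewrite divr_gt0 // subr_gt0 al_gt1. Qed.

Lemma radius_gt0 : 0 < rho.
Proof. by rewrite divr_gt0 // subr_gt0 alco_gt_sb. Qed.

(* Half-angle formulas for the sides d, h from 0 to the vertices of orders 2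
   and b: here cosh d = al, sinh d = be and tanh h = be / (al * co). *)
Lemma vert2_tanh : be * (1 + p ^+ 2) = 2 * al * p.
Proof.
have e : be ^+ 2 * (1 + p ^+ 2) = be * (2 * al * p).
  rewrite /p mulrDr mulr1 -exprMn mulrCA divff ?lt0r_neq0 // mulr1.
  rewrite (_ : be * _ = 2 * al * (be * ((al - 1) / be))); last by ring.
  by rewrite (mulrCA be) divff ?lt0r_neq0 //; have := albe; lra.
by apply: (mulfI (lt0r_neq0 be0)); rewrite -e; ring.
Qed.

Lemma vert2_sinh : be * (1 - p ^+ 2) = 2 * p.
Proof.
have e : be ^+ 2 * (1 - p ^+ 2) = be * (2 * p).
  rewrite /p mulrBr mulr1 -exprMn mulrCA divff ?lt0r_neq0 // mulr1.
  rewrite (mulrCA be 2) (mulrCA be) divff ?lt0r_neq0 //; have := albe; lra.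
by apply: (mulfI (lt0r_neq0 be0)); rewrite -e; ring.
Qed.

Let berho : be * rho = al * co - sb.
Proof. by rewrite /rho mulrCA divff ?lt0r_neq0 // mulr1. Qed.

Lemma radius_tanh : be * (1 + rho ^+ 2) = 2 * al * rho * co.
Proof.
apply: (mulfI (lt0r_neq0 be0)).
have -> : be * (2 * al * rho * co) = 2 * (al * co) * (be * rho) by ring.
have -> : be * (be * (1 + rho ^+ 2)) = be ^+ 2 + (be * rho) ^+ 2 by ring.
by rewrite berho -circumradius_identity; ring.
Qed.

Lemma radius_sinh : be * (1 - rho ^+ 2) = 2 * rho * sb.
Proof.
apply: (mulfI (lt0r_neq0 be0)).
have -> : be * (2 * rho * sb) = 2 * sb * (be * rho) by ring.
have -> : be * (be * (1 - rho ^+ 2)) = be ^+ 2 - (be * rho) ^+ 2 by ring.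
by rewrite berho -circumradius_identity; ring.
Qed.

Lemma vert2_lt1 : p ^+ 2 < 1.
Proof.
rewrite -subr_gt0 -(pmulr_rgt0 _ be0) vert2_sinh.
by rewrite mulr_gt0 // vert2_gt0.
Qed.

Lemma nsq_vertb : nsq q = rho ^+ 2.
Proof. by rewrite /nsq /= !exprMn -mulrDr cs mulr1. Qed.

Lemma radius_lt1 : rho ^+ 2 < 1.
Proof.
rewrite -subr_gt0 -(pmulr_rgt0 _ be0) radius_sinh.
have r0 := radius_gt0; by apply: mulr_gt0 sb0; apply: mulr_gt0.
Qed.

(** The relation tanh d = tanh h cos(pi/m), which puts the right angle at [p]. *)
Lemma right_angle : rho * co * (1 + p ^+ 2) = p * (1 + rho ^+ 2).
Proof.
apply: (mulfI (lt0r_neq0 be0)).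
rewrite mulrCA vert2_tanh (mulrCA be) radius_tanh; ring.
Qed.

Lemma triangle_angles :
  [/\ hangle_eq p%:C q 0 (pi / 2%:R), hangle_eq q 0 p%:C (pi / b%:R)
    & hangle_eq 0 p%:C q (pi / m%:R)].
Proof.
have p0 := vert2_gt0; have r0 := radius_gt0.
have p1 := vert2_lt1; have r1 := radius_lt1.
split.
- have E : complex.Re (phi p%:C q * conjc (phi p%:C 0)) = 0.
    rewrite phi_at0 /phi cconjE conjc_real mulrAC Re_div.
    suff -> : complex.Re ((q - p%:C) * conjc (- p%:C) * conjc (1 - p%:C * q)) = 0 by rewrite mul0r.
    (* co^2 + si^2 is kept in place of 1 so that [ring] proves the identity without the relation
       between them. *)
    have -> : complex.Re ((q - p%:C) * conjc (- p%:C) * conjc (1 - p%:C * q))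
        = - p * (rho * co * (1 + p ^+ 2) - p * (1 + rho ^+ 2 * (co ^+ 2 + si ^+ 2))).
      by rewrite /q /=; ring.
    by rewrite cs mulr1 right_angle subrr mulr0.
  change (complex.Re (phi p%:C q * cconj (phi p%:C 0))
    = complex.Re (`|phi p%:C q| * `|phi p%:C 0|) * cos (pi / 2%:R)).
  by rewrite cconjE E cos_pihalf mulr0.
- have D0 : 0 < nsq (1 - conjc q * p%:C).
    rewrite nsq_gt0 subr_eq0; apply/negP => /eqP /(congr1 nsq).
    rewrite nsqM nsqJ nsq_vertb !nsq_real; nra.
  set D := nsq _ in D0.
  (* A sum of two squares, the first of which vanishes by [right_angle]; hence |phi q p| = rho si (1
     - p^2) / D, free of square roots. *)
  have nn : nsq (p%:C - q) * D = (rho * si * (1 - p ^+ 2)) ^+ 2.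
    have -> : nsq (p%:C - q) * D = (rho * co * (1 + p ^+ 2) - p * (1 + rho ^+ 2 * (co ^+ 2 + si ^+ 2))) ^+ 2
          + (rho * si * (1 - p ^+ 2)) ^+ 2.
      rewrite /D /nsq /q /=; ring.
    by rewrite cs mulr1 right_angle subrr expr0n add0r.
  pose Y := rho * (rho * si * (1 - p ^+ 2)) / D.
  apply: (hangleI (Y := Y)).
  + apply: divr_ge0 (ltW D0); apply: mulr_ge0 (ltW r0) _; apply: mulr_ge0.
      exact: mulr_ge0 (ltW r0) (ltW si0).
    by rewrite subr_ge0 ltW.
  + rewrite phi_at0 /phi cconjE nsq_div -/D.
    have -> : nsq (- q) = rho ^+ 2 by rewrite -nsq_vertb; case: (q) => ? ?; rewrite /nsq /= !sqrrN.
    have -> : nsq (p%:C - q) = (rho * si * (1 - p ^+ 2)) ^+ 2 / D.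
      by rewrite -nn mulfK // lt0r_neq0.
    by rewrite /Y; field; exact: lt0r_neq0.
  rewrite phi_at0 Re_mulJ /phi cconjE mulrAC Re_div -/D.
  rewrite /Y [RHS]mulrAC; congr (_ / _).
  have -> : complex.Re ((p%:C - q) * conjc (- q) * conjc (1 - conjc q * p%:C))
    = rho ^+ 2 * (co ^+ 2 + si ^+ 2) * (1 + p ^+ 2) - p * rho * co * (1 + rho ^+ 2 * (co ^+ 2 + si ^+ 2)).
    by rewrite /q /=; ring.
  rewrite cs !mulr1 -angle; apply: (mulfI (lt0r_neq0 be0)).
  have -> : be * (rho ^+ 2 * (1 + p ^+ 2) - p * rho * co * (1 + rho ^+ 2))
      = rho ^+ 2 * (be * (1 + p ^+ 2)) - p * rho * co * (be * (1 + rho ^+ 2)) by ring.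
  have -> : be * (rho * (rho * si * (1 - p ^+ 2)) * (al * si))
      = rho ^+ 2 * al * si ^+ 2 * (be * (1 - p ^+ 2)) by ring.
  rewrite vert2_tanh radius_tanh vert2_sinh sin2cos2; ring.
- pose Y := p * rho; apply: (hangleI (Y := Y)); first by rewrite mulr_ge0 ?ltW.
    by rewrite !phi0 nsq_vertb nsq_real exprMn.
  by rewrite !phi0 /=; simpc; rewrite /= mulrA.
Qed.

Lemma triangle_vertices :
  [/\ in_disc p%:C, in_disc q & in_disc (0 : C)] /\ [/\ p%:C != q, q != 0 & p%:C != 0 :> C].
Proof.
have p0 := vert2_gt0; have r0 := radius_gt0.
split; split.
- by apply/in_discE; rewrite nsq_real vert2_lt1.
- by apply/in_discE; rewrite nsq_vertb radius_lt1.
- by apply/in_discE; rewrite (nsq_real 0) expr0n ltr01.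
- rewrite eq_complex /= negb_and; apply/orP; right.
  by rewrite eq_sym mulf_neq0 // lt0r_neq0.
- by rewrite -nsq_eq0 nsq_vertb expf_eq0 /= lt0r_neq0.
- by rewrite -nsq_eq0 nsq_real expf_eq0 /= lt0r_neq0.
Qed.

Lemma rot_vert2_proj :
  proj_eq (rot_mx p%:C (2 * pi / 2%:R)) (mx2 (- al%:C) be%:C (- be%:C) al%:C).
Proof.
have p0 := vert2_gt0; have p1 := vert2_lt1.
apply: proj_trans; first by apply: rot_mx_proj; rewrite nsq_real.
have -> : 2 * pi / 2%:R = pi :> R by rewrite mulrAC divff ?mul1r // pnatr_eq0.
exists (2 * p / be)%:C.
  rewrite fmorph_eq0 mulf_neq0 ?invr_eq0 ?lt0r_neq0 // mulr_gt0 //.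
have e : 1 + p ^+ 2 = 2 * p / be * al.
  apply: (mulfI (lt0r_neq0 be0)); rewrite vert2_tanh; field; exact: lt0r_neq0.
have e' : 2 * p = 2 * p / be * be by field; exact: lt0r_neq0.
rewrite cospi sinpi scale_mx2 nsq_real conjc_real.
apply: mx2P; rewrite !mxE /=; apply/eqP; rewrite eq_complex /=; apply/andP; split; apply/eqP.
all: move: e e'; set k := 2 * p / be; move=> e e'; lra.
Qed.

(** Suitably ordered, the rotations about the three vertices multiply to the identity: the one about
    [q] is the rotation by -2 pi / m about 0 followed by the half-turn about [p]. *)
Lemma rot_vertb_proj :
  proj_eq (rot_mx q (2 * pi / b%:R))
    (mx2 (- al%:C) be%:C (- be%:C) al%:C *m mx2 (conjc z) 0 0 1).
Proof.
have r0 := radius_gt0; have r1 := radius_lt1.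
have q1 : nsq q < 1 by rewrite nsq_vertb.
apply: proj_trans; first exact: rot_mx_proj.
set l := _ +i* _; pose f : C := cb +i* sb; pose e : C := co +i* si.
have lE : l = f * f.
  rewrite /l (_ : 2 * pi / b%:R = pi / b%:R *+ 2); last by rewrite -mulrA mulr_natl.
  rewrite cos_mulr2n sin_mulr2n /f; simpc; rewrite /=.
  by congr (_ +i* _); have := csb; lra.
have ff : f * conjc f = 1.
  by rewrite -nsqE /nsq /= csb.
have ee : e * conjc e = 1.
  by rewrite -nsqE /nsq /= cs.
have ze : z = e * e.
  by rewrite zetaE /e; simpc; congr (_ +i* _); ring.
have qE : q = rho%:C * e by rewrite /q /e; simpc.
have beC : be%:C != 0 :> C by rewrite fmorph_eq0 lt0r_neq0.
(* The equation [key] divided by f = e^(i pi/b), which separates cleanly: the real part is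
   [radius_sinh] with [angle], the imaginary part [radius_tanh]. *)
have key0 : be%:C * (conjc f - f * (rho ^+ 2)%:C) = al%:C * q * (conjc f - f).
  rewrite /f /q; apply/eqP; rewrite eq_complex /=; apply/andP; split; apply/eqP.
    have := radius_sinh; rewrite -angle => h.
    transitivity (al * si * (be * (1 - rho ^+ 2))); first by ring.
    by rewrite h; ring.
  transitivity (- sb * (be * (1 + rho ^+ 2))); first by ring.
  by rewrite radius_tanh; ring.
have key : be%:C * (1 - l * (rho ^+ 2)%:C) = al%:C * q * (1 - l).
  have -> : 1 - l * (rho ^+ 2)%:C = f * (conjc f - f * (rho ^+ 2)%:C).
    by rewrite mulrBr ff lE; ring.
  have -> : 1 - l = f * (conjc f - f) by rewrite mulrBr ff lE.
  by rewrite mulrCA key0; ring.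
have l1 : l * conjc l = 1 by rewrite lE conjcM mulrACA ff mulr1.
have key' : be%:C * (l - (rho ^+ 2)%:C) = al%:C * conjc q * (l - 1).
  have := congr1 conjc key; rewrite !conjcM conjc_real => h.
  transitivity (l * (be%:C * conjc (1 - l * (rho ^+ 2)%:C))).
    rewrite conjcB (conjcM l) (conjc_real (rho ^+ 2)) (conjc_real 1) realC1.
    transitivity (be%:C * (l - (l * conjc l) * (rho ^+ 2)%:C)); first by rewrite l1 mul1r.
    by ring.
  rewrite h (conjc_real al) conjcB (conjc_real 1) realC1.
  transitivity (al%:C * conjc q * (l - l * conjc l)); last by rewrite l1.
  by ring.
have qz : conjc q = q * conjc z.
  by rewrite qE ze !conjcM conjc_real -[LHS]mulr1 -ee; ring.
have l_neq1 : 1 - l != 0.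
  rewrite lE -ff -mulrBr mulf_neq0 //.
    by apply: contra_eq_neq ff => ->; rewrite mul0r eq_sym oner_neq0.
  rewrite eq_complex /= negb_and; apply/orP; right.
  by have := sb0; rewrite -opprD oppr_eq0 -mulr2n mulrn_eq0 /= => /lt0r_neq0.
exists (q * (1 - l) / be%:C).
  rewrite !mulf_neq0 ?invr_eq0 //; by have [_ []] := triangle_vertices.
rewrite mul_mx2 scale_mx2 nsq_vertb; congr mx2.
- by apply: (mulfI beC); rewrite key' qz; field.
- by field.
- by rewrite qz; field.
- by apply: (mulfI beC); rewrite key; field.
Qed.

End Triangle.
End Hyperbolic_geometry.

(** * A criterion for triangle groups *)

Section Criterion.
Variables (R : realType) (m b : nat) (ks : seq nat).
Local Notation C := (R[i]).
Local Notation z := (zeta R m).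
Local Notation ev := (ev R m).
Local Notation co := (cos (pi / m%:R) : R).
Local Notation si := (sin (pi / m%:R) : R).
Local Notation cb := (cos (pi / b%:R) : R).
Local Notation sb := (sin (pi / b%:R) : R).
Hypotheses (m2 : (2 < m)%N) (b2 : (2 < b)%N).
Hypothesis pks : perm_eq [seq k <- iota 0 m | coprime k m]
                         ((1%N :: ks) ++ map (subn m) (1%N :: ks)).
Hypothesis small_chord : (2 - 2 * co) * 4 ^+ size ks < 1.
Variables (w : R) (wk : nat -> R) (v : nat) (U : {poly int}).
Local Notation G := (Gamma m w%:C).
Hypothesis w0 : 0 < w.
Hypothesis v0 : (0 < v)%N.
Hypothesis U1 : ev 1 U = (v%:R * w)%:C.
Hypothesis Uk : forall k, k \in ks -> ev k U = (v%:R * wk k)%:C.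
Hypothesis wk_lt0 : forall k, k \in ks -> wk k < 0.
(** The polynomials witness that s, t, w t eps and eps lie in Z[zeta]. The phase eps = s / conj s
    allows s to be non-real; the determinant of S is -eps. *)
Variables (t : R) (Fs Ft Fw Fe : {poly int}).
Local Notation s := (ev 1 Fs).
Local Notation eps := (ev 1 Fe).
Hypothesis t0 : 0 < t.
Hypothesis tE : ev 1 Ft = t%:C.
Hypothesis wtE : ev 1 Fw = w%:C * t%:C * eps.
(* S = [[s, - w t eps], [t, - s]] is an involution in PGL, and [angle] makes
   S Rot^-1 a rotation of order b. *)
Hypothesis sJ : s = eps * conjc s.
Hypothesis ns : nsq s = 1 + w * t ^+ 2.
Hypothesis angle : nsq s * si ^+ 2 = cb ^+ 2.
Hypothesis no_small : forall F, ev 1 F != 0 ->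
  (forall k, k \in ks -> 0 <= 1 + wk k * nsq (ev k F)) ->
  (1 + 2 * w * nsq (ev 1 F)) ^+ 2 * sb ^+ 2 <= co ^+ 2 * nsq s -> False.

Let m0 : (0 < m)%N := ltn_trans (isT : 0 < 2)%N m2.
Let be2 : 0 < w * t ^+ 2.
Proof. by rewrite mulr_gt0 // exprn_gt0. Qed.
Let al : R := Num.sqrt (nsq s).
Let be : R := Num.sqrt w * t.
Let S : 'M[C]_2 := mx2 s (- (w%:C * t%:C * eps)) t%:C (- s).
Let Rot : 'M[C]_2 := mx2 1 0 0 z.

Let al2 : al ^+ 2 = nsq s.
Proof. by rewrite sqr_sqrtr ?nsq_ge0. Qed.

Let al0 : 0 < al.
Proof. by rewrite sqrtr_gt0 ns; have := be2; lra. Qed.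

Let be0 : 0 < be.
Proof. by rewrite mulr_gt0 // sqrtr_gt0. Qed.

Let albe : al ^+ 2 = 1 + be ^+ 2.
Proof. by rewrite al2 ns exprMn sqr_sqrtr ?ltW. Qed.

Let al_angle : al * si = cb.
Proof.
have s0 := sin_pi_div_gt0 R m2; have c0 := cos_pi_div_gt0 R b2.
have h : (al * si) ^+ 2 = cb ^+ 2 by rewrite exprMn al2.
apply/eqP; rewrite -(eqrXn2 (n := 2)) ?h //; last exact: ltW.
by rewrite mulr_ge0 // ltW.
Qed.

Let neps : nsq eps = 1.
Proof.
have n0 : nsq s != 0 by rewrite -al2 expf_eq0 /= lt0r_neq0.
by apply: (mulIf n0); rewrite mul1r -[in LHS](nsqJ s) -nsqM -sJ.
Qed.

Let epsJ : eps * conjc eps = 1.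
Proof. by rewrite -nsqE neps. Qed.

Let s2 : s * s = eps * (nsq s)%:C.
Proof. by rewrite nsqE {1}sJ; ring. Qed.

Let GS : G S.
Proof.
have Zs : in_Zzeta m s by exact: in_Zzeta_ev.
have Zn F : in_Zzeta m (- ev 1 F) by rewrite -evN; exact: in_Zzeta_ev.
have ZS i j : in_Zzeta m (S i j).
  rewrite mxE; case: ifP => _; case: ifP => _ //.
    by rewrite -wtE.
  by rewrite -tE; exact: in_Zzeta_ev.
have nsC : (nsq s)%:C = 1 + w%:C * t%:C * t%:C.
  by rewrite ns (realCD 1) !realCM realC1; ring.
(* S^2 is the scalar eps, so conj(eps) S is an inverse with entries in Z[zeta]. *)
apply: (Gamma_intro (B := conjc eps *: S)) => //.
- rewrite -scalemxAr mul_mx2 scale_mx2 scalar_mx2; congr mx2.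
  + rewrite s2 nsC -[RHS]epsJ; ring.
  + ring.
  + ring.
  + rewrite mulrNN s2 nsC -[RHS]epsJ; ring.
- move=> i j; rewrite mxE -(ev_star R m0).
  have /in_ZzetaP[F ->] := ZS i j.
  by rewrite -evM; exact: in_Zzeta_ev.
- by rewrite !mxE /= nsq_real.
- rewrite !mxE /= sJ.
  have -> : conjc (- (w%:C * t%:C * eps)) = - (w%:C * t%:C * conjc eps).
    by rewrite conjcN !conjcM !conjc_real.
  have -> : conjc (- (eps * conjc s)) = - (conjc eps * s).
    by rewrite conjcN !conjcM conjcK.
  rewrite -sJ; ring.
- have nsqN x : nsq (- x) = nsq x :> R by case: x => ? ?; rewrite /nsq /= !sqrrN.
  rewrite !mxE /= !nsqN !nsqM !nsq_real neps ns; ring.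
Qed.

Theorem triangle_criterion : triangle_group G 2 b m.
Proof.
(* A square root of eps, used to turn the coordinate until S becomes the real matrix [S0]. *)
pose eta : C := s / al%:C.
have alC : al%:C != 0 :> C by rewrite fmorph_eq0 lt0r_neq0.
have sE : s = al%:C * eta by rewrite /eta mulrCA divff // mulr1.
have eta2 : eta * eta = eps.
  rewrite /eta mulrACA s2 -invfM -realCM -expr2 al2 mulfK //.
  by rewrite fmorph_eq0 -al2 expf_eq0 /= lt0r_neq0.
have eta0 : eta != 0.
  by apply: contraTneq (oner_neq0 C) => e0; rewrite -epsJ -eta2 e0 !mul0r eqxx.
pose x : C := (Num.sqrt w)%:C * eta.
have sw : (Num.sqrt w)%:C * (Num.sqrt w)%:C = w%:C :> C.
  by rewrite -realCM -expr2 sqr_sqrtr // ltW.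
have x0 : x != 0 by rewrite mulf_neq0 // fmorph_eq0 lt0r_neq0 // sqrtr_gt0.
(* In the coordinate z = (first entry) / (second entry) the negative vectors of the form fill |z|^2
   > w. As |x|^2 = w, the map z -> x / z sends this region to the unit disc and the centre, at z =
   infinity, to 0. *)
pose T : 'M[C]_2 := mx2 0 x 1 0.
have uT : T \in unitmx by apply: mx2_unit; rewrite mul0r sub0r mulr1 oppr_eq0.
pose p := vert2 al be; pose q := vertb m b al be.
pose S0 : 'M[C]_2 := mx2 (- al%:C) be%:C (- be%:C) al%:C.
pose D : 'M[C]_2 := mx2 (conjc z) 0 0 1.
pose E : 'M[C]_2 := mx2 1 0 0 (conjc z).
set g1 := invmx T *m rot_mx p%:C (2 * pi / 2%:R) *m T.
set g2 := invmx T *m rot_mx q (2 * pi / b%:R) *m T.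
have S0T : proj_eq (S0 *m T) (T *m S).
  apply: proj_sym; exists eta => //; rewrite /S0 /T /S !mul_mx2 scale_mx2 /x /be realCM.
  congr mx2; rewrite ?sE -?eta2 -?sw; ring.
have DT : D *m T = T *m E by rewrite !mul_mx2; congr mx2; ring.
have conjT A B : proj_eq (A *m T) (T *m B) -> proj_eq (invmx T *m A *m T) B.
  move=> h; rewrite -mulmxA -[X in proj_eq _ X](mulKmx uT).
  exact: proj_mul (proj_refl _) h.
have zc : z * conjc z = 1 by rewrite -nsqE -[z]expr1 nsq_zetaX.
have RE : Rot *m E = 1%:M.
  by rewrite mul_mx2 scalar_mx2 zc !(mulr0, mul0r, addr0, add0r, mulr1).
have iR : invmx Rot = E by exact: invmx_uniq.
have GR : G Rot := Gamma_Rot m2 w.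
have GE : G E by rewrite -iR; exact: Gamma_inv.
have r1 : proj_eq (rot_mx p%:C (2 * pi / 2%:R)) S0.
  exact: (rot_vert2_proj al0 be0 albe).
have r2 : proj_eq (rot_mx q (2 * pi / b%:R)) (S0 *m D).
  exact: (rot_vertb_proj m2 b2 al0 be0 albe al_angle).
have h1 : proj_eq g1 S.
  apply: conjT; apply: proj_trans S0T; exact: proj_mul r1 (proj_refl T).
have h2 : proj_eq g2 (S *m E).
  apply: conjT; apply: proj_trans (proj_mul r2 (proj_refl T)) _.
  rewrite -mulmxA DT !mulmxA; exact: proj_mul S0T (proj_refl E).
have uS := Gamma_unit GS; have uE := Gamma_unit GE.
have proj_unit A B : proj_eq A B -> B \in unitmx -> A \in unitmx.
  by case=> l l0 ->; rewrite unitmxZ // unitfE.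
have u1 : g1 \in unitmx by exact: proj_unit h1 uS.
have u2 : g2 \in unitmx by apply: proj_unit h2 _; rewrite unitmx_mul uS uE.
have [[dp dq d0] [npq nq0 np0]] := triangle_vertices m2 b2 al0 be0 albe al_angle.
have [a1 a2 a3] := triangle_angles m2 b2 al0 be0 albe al_angle.
exists T, p%:C, q, 0; split; [exact: uT | by split | by split | by split | split].
- pose P A := exists2 B, gen2 g1 g2 B & proj_eq A B.
  have Pmul A B : P A -> P B -> P (A *m B).
    case=> A' gA pA [B' gB pB]; exists (A' *m B'); first exact: (gen2_mul gA gB).
    exact: proj_mul pA pB.
  have Pinv A : A \in unitmx -> P A -> P (invmx A).
    move=> uA [B gB pB]; exists (invmx B); first exact: (gen2_inv u1 u2 gB).
    exact: proj_inv (gen2_unit u1 u2 gB) pB.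
  have Pscal (l : C) : l != 0 -> P l%:M.
    by move=> l0; exists 1%:M; [constructor | exists l; rewrite // scalemx1].
  have PS : P S by exists g1; [exact: gen2_fst | exact: proj_sym h1].
  have PSE : P (S *m E) by exists g2; [exact: gen2_snd | exact: proj_sym h2].
  have PR : P Rot.
    have -> : Rot = invmx (S *m E) *m S.
      by rewrite (invmx_mul uS uE) -iR invmxK -mulmxA (mulVmx uS) mulmx1.
    apply: (Pmul _ _ _ PS); apply: Pinv PSE.
    by rewrite unitmx_mul uS uE.
  have S10 : S 1 0 != 0 by rewrite mxE /= fmorph_eq0 lt0r_neq0.
  have S01 : nsq (S 0 1) = w ^+ 2 * nsq (S 1 0).
    rewrite !mxE /=; have nsqN y : nsq (- y) = nsq y :> R by case: y => ? ?; rewrite /nsq /= !sqrrN.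
    rewrite nsqN !nsqM !nsq_real neps; ring.
  have cr : co ^+ 2 * nsq (S 0 0) - w * nsq (S 1 0) = sb ^+ 2.
    rewrite !mxE /= nsq_real -al2 -exprMn.
    have := circumradius_identity albe al_angle.
    rewrite (_ : w * t ^+ 2 = be ^+ 2); last by rewrite /be exprMn sqr_sqrtr ?ltW.
    by rewrite (mulrC co); lra.
  have ns' : forall F, ev 1 F != 0 ->
      (forall k, k \in ks -> 0 <= 1 + wk k * nsq (ev k F)) ->
      (1 + 2 * w * nsq (ev 1 F)) ^+ 2 * sb ^+ 2 <= co ^+ 2 * nsq (S 0 0) -> False.
    by move=> F; rewrite [S 0 0]mxE; exact: no_small.
  have gen := Gamma_generated m2 pks small_chord w0 v0 U1 Uk wk_lt0 GS S10 S01 cr ns'.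
  exact: (gen P Pmul Pinv Pscal PR PS).
- have GSE : G (S *m E) := Gamma_mul GS GE.
  move=> B; elim.
  + exists 1%:M; last exact: proj_refl.
    rewrite -(mulVmx uS); exact: Gamma_mul (Gamma_inv GS) GS.
  + move=> X _ [A GA pA]; exists (A *m S); first exact: Gamma_mul GA GS.
    exact: proj_mul pA h1.
  + move=> X _ [A GA pA]; exists (A *m invmx S).
      exact: Gamma_mul GA (Gamma_inv GS).
    exact: proj_mul pA (proj_inv uS h1).
  + move=> X _ [A GA pA]; exists (A *m (S *m E)); first exact: Gamma_mul GA GSE.
    exact: proj_mul pA h2.
  + move=> X _ [A GA pA]; exists (A *m invmx (S *m E)).
      exact: Gamma_mul GA (Gamma_inv GSE).
    exact: proj_mul pA (proj_inv (Gamma_unit GSE) h2).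
Qed.

End Criterion.

(** * Real cyclotomic traces *)

Section Trace.
Variables (R : realType) (m : nat).
Hypothesis m2 : (2 < m)%N.
Local Notation z := (zeta R m).
Local Notation ev := (ev R m).
Let m0 : (0 < m)%N := ltn_trans (isT : 0 < 2)%N m2.

Definition tr (k : nat) : R := 2 * cos (2 * pi / m%:R *+ k).
Definition trace_poly : {poly int} := 'X + star m 'X.
Local Notation p := (tr 1).

Lemma tr_conj k : z ^+ k + conjc (z ^+ k) = (tr k)%:C.
Proof. by rewrite zetaX /tr; simpc; congr (_ +i* _); ring. Qed.

Lemma ev_trace_poly k : ev k trace_poly = (tr k)%:C.
Proof. by rewrite evD ev_star // -[X in ev k X]expr1 evXn muln1 tr_conj. Qed.

Lemma p1E : p1 R m = p%:C.
Proof. by rewrite /p1 cconjE -tr_conj expr1. Qed.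

Lemma p5E : p5 R m = (tr 5)%:C.
Proof. by rewrite /p5 cconjE -tr_conj. Qed.

Lemma trSS k : tr k.+2 = p * tr k.+1 - tr k.
Proof.
rewrite /tr mulr1n; set x := 2 * pi / _.
have -> : x *+ k.+2 = x *+ k.+1 + x by rewrite [LHS]mulrSr.
have -> : cos (x *+ k) = cos (x *+ k.+1 - x) by rewrite mulrSr addrK.
by rewrite cosD cosB; ring.
Qed.

Lemma tr0 : tr 0 = 2.
Proof. by rewrite /tr mulr0n cos0 mulr1. Qed.

(** Expanded by [trSS], this is a polynomial equation for [tr 1], from which its minimal polynomial
    is extracted. *)
Lemma tr_half k : (k * 2)%N = m -> tr k = - 2.
Proof.
move=> km; rewrite /tr (_ : _ *+ k = pi) ?cospi ?mulrN1 //.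
rewrite -[X in _ *+ X]/(k) -mulr_natr -km natrM.
have k0 : k%:R != 0 :> R by rewrite pnatr_eq0; apply: contraTneq m0 => k0; rewrite -km k0.
by field.
Qed.

Lemma sin2_tr : 4 * sin (pi / m%:R) ^+ 2 = 2 - p :> R.
Proof.
rewrite /tr mulr1n (_ : 2 * pi / m%:R = pi / m%:R *+ 2); last by rewrite -mulrA mulr_natl.
by rewrite cos_mulr2n sin2cos2; ring.
Qed.

Lemma cos2_tr : 4 * cos (pi / m%:R) ^+ 2 = 2 + p :> R.
Proof. by have := sin2_tr; rewrite sin2cos2; lra. Qed.

Lemma nsq_zetaD1 : nsq (1 + z) = 2 + p.
Proof. by rewrite /nsq /zeta /tr mulr1n /=; have := cos2Dsin2 (2 * pi / m%:R : R); lra. Qed.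

(** [d] will be a rational lower bound for cos(pi/m), tested through 4 cos^2(pi/m) = 2 + p. *)
Lemma small_chord_of n (d : R) : 0 <= d -> (2 - 2 * d) * 4 ^+ n < 1 -> 4 * d ^+ 2 < 2 + p ->
  (2 - 2 * cos (pi / m%:R)) * 4 ^+ n < 1 :> R.
Proof.
move=> d0 dn; rewrite -cos2_tr ltr_pM2l // => h.
apply: le_lt_trans dn; rewrite ler_wpM2r ?exprn_ge0 //.
have c0 := cos_pi_div_gt0 R m2.
have {}h : d < cos (pi / m%:R) by rewrite -ltr_sqr ?nnegrE // ltW.
lra.
Qed.

End Trace.

(** * Minimal polynomials and rational bounds for 2 cos(2 pi / m) *)

Lemma cos_pi3 (R : realType) : cos (pi / 3%:R) = 1 / 2 :> R.
Proof.
have c0 := @cos_pi_div_gt0 R 3 isT; set c := cos _ in c0 *.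
have : cos (pi : R) = 4 * c ^+ 3 - 3 * c.
  have -> : pi = pi / 3%:R *+ 2 + pi / 3%:R :> R by rewrite mulr2n; field.
  rewrite cosD cos_mulr2n sin_mulr2n -/c.
  transitivity ((2 * c ^+ 2 - 1) * c - 2 * c * sin (pi / 3%:R) ^+ 2); first by ring.
  by rewrite sin2cos2 -/c; ring.
rewrite cospi => h.
have : (c + 1) * (2 * c - 1) ^+ 2 == 0 by apply/eqP; lra.
by rewrite mulf_eq0 expf_eq0 /= => /orP[/eqP|/eqP]; lra.
Qed.

(** Since 2 pi / m < pi / 3. This bound discards the factors coming from roots of unity of smaller
    order and singles out the right root of the remaining one. *)
Lemma tr1_gt1 (R : realType) m : (6 < m)%N -> 1 < tr R m 1.
Proof.
move=> m6; rewrite /tr mulr1n -ltr_pdivrMl //.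
have mR : 0 < m%:R :> R by rewrite ltr0n (ltn_trans _ m6).
have p0 := pi_gt0 R.
rewrite (_ : 2^-1 * 1 = cos (pi / 3%:R)); last by rewrite cos_pi3; lra.
have le : 2 * pi / m%:R < pi / 3%:R :> R.
  rewrite ltr_pdivrMr // mulrAC ltr_pdivlMr // -mulrA mulrCA ltr_pM2l //.
  by rewrite -natrM ltr_nat.
have pos : 0 <= 2 * pi / m%:R :> R by rewrite divr_ge0 ?mulr_ge0 // ltW.
have p3 : pi / 3%:R <= pi :> R by lra.
by rewrite ltr_cos // in_itv /=; apply/andP; split; lra.
Qed.

Section Minimal_polynomials.
Variable R : realType.

Lemma tr12 : tr R 12 1 ^+ 2 = 3.
Proof.
have p1 := @tr1_gt1 R 12 isT; have := @tr_half R 12 isT 6 erefl.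
rewrite !trSS tr0; set p := tr R 12 1 in p1 * => h.
have : (p * (p ^+ 2 - 3)) ^+ 2 == 0 by apply/eqP; lra.
by rewrite expf_eq0 /= mulf_eq0 => /orP[/eqP|/eqP]; lra.
Qed.

Lemma tr10 : tr R 10 1 ^+ 2 = tr R 10 1 + 1.
Proof.
have p1 := @tr1_gt1 R 10 isT; have := @tr_half R 10 isT 5 erefl.
rewrite !trSS tr0; set p := tr R 10 1 in p1 * => h.
have : (p + 2) * (p ^+ 2 - p - 1) ^+ 2 == 0 by apply/eqP; lra.
by rewrite mulf_eq0 expf_eq0 /= => /orP[/eqP|/eqP]; lra.
Qed.

Lemma tr18 : tr R 18 1 ^+ 3 = 3 * tr R 18 1 + 1.
Proof.
have p1 := @tr1_gt1 R 18 isT; have := @tr_half R 18 isT 9 erefl.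
rewrite !trSS tr0; set p := tr R 18 1 in p1 * => h.
(* z^9 = -1 also admits roots of unity of orders 2 and 6; they give the factors p + 2 and p - 1. *)
have : (p + 2) * ((p - 1) * (p ^+ 3 - 3 * p - 1)) ^+ 2 == 0 by apply/eqP; lra.
by rewrite mulf_eq0 expf_eq0 /= mulf_eq0 => /or3P[/eqP|/eqP|/eqP]; lra.
Qed.

Lemma tr14 : tr R 14 1 ^+ 3 = tr R 14 1 ^+ 2 + 2 * tr R 14 1 - 1.
Proof.
have p1 := @tr1_gt1 R 14 isT; have := @tr_half R 14 isT 7 erefl.
rewrite !trSS tr0; set p := tr R 14 1 in p1 * => h.
have : (p + 2) * (p ^+ 3 - p ^+ 2 - 2 * p + 1) ^+ 2 == 0 by apply/eqP; lra.
by rewrite mulf_eq0 expf_eq0 /= => /orP[/eqP|/eqP]; lra.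
Qed.

End Minimal_polynomials.

Section Bounds.
Variable R : realType.

Lemma tr12_bounds : 12 / 7 < tr R 12 1 < 7 / 4.
Proof. have := @tr1_gt1 R 12 isT; have := tr12 R; nra. Qed.

Lemma tr10_bounds : 8 / 5 < tr R 10 1 < 13 / 8.
Proof. have := @tr1_gt1 R 10 isT; have := tr10 R; nra. Qed.

Lemma tr18_bounds : 15 / 8 < tr R 18 1 < 17 / 9.
Proof.
have := @tr1_gt1 R 18 isT; have := tr18 R; set p := tr R 18 1 => h p1.
apply/andP; split; rewrite ltNge; apply/negP => le.
  (* The last factor is chosen so that the p^2 terms cancel; [h] then makes the inequality linear in
     p. *)
  have : 0 <= (p - 1) * (15 / 8 - p) * (p + 23 / 8) by rewrite !mulr_ge0; lra.
  lra.
have : 0 <= (p - 17 / 9) * (p * p + 17 / 9 * p) by apply: mulr_ge0; nra.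
lra.
Qed.

Lemma tr14_bounds : 9 / 5 < tr R 14 1 < 20 / 11.
Proof.
have := @tr1_gt1 R 14 isT; have := tr14 R; set p := tr R 14 1 => h p1.
apply/andP; split; rewrite ltNge; apply/negP => le.
  have : 0 <= (p - 1) * (9 / 5 - p) * (p + 9 / 5) by rewrite !mulr_ge0; lra.
  lra.
have : 0 <= (p - 20 / 11) * (p * p + 9 / 11 * p + (20 / 11 * (9 / 11) - 2)).
  by apply: mulr_ge0; nra.
lra.
Qed.

Lemma tr12_5 : tr R 12 5 = - tr R 12 1.
Proof. rewrite !trSS tr0; have := tr12 R; set p := tr R 12 1 => h; ring: h. Qed.

Lemma tr10_3 : tr R 10 3 = 1 - tr R 10 1.
Proof. rewrite !trSS tr0; have := tr10 R; set p := tr R 10 1 => h; ring: h. Qed.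

Lemma tr18_5 : tr R 18 5 = tr R 18 1 ^+ 2 - tr R 18 1 - 2.
Proof. rewrite !trSS tr0; have := tr18 R; set p := tr R 18 1 => h; ring: h. Qed.

Lemma tr18_7 : tr R 18 7 = 2 - tr R 18 1 ^+ 2.
Proof. rewrite !trSS tr0; have := tr18 R; set p := tr R 18 1 => h; ring: h. Qed.

Lemma tr14_3 : tr R 14 3 = tr R 14 1 ^+ 2 - tr R 14 1 - 1.
Proof. rewrite !trSS tr0; have := tr14 R; set p := tr R 14 1 => h; ring: h. Qed.

Lemma tr14_5 : tr R 14 5 = 2 - tr R 14 1 ^+ 2.
Proof. rewrite !trSS tr0; have := tr14 R; set p := tr R 14 1 => h; ring: h. Qed.

Lemma small_chord12 : (2 - 2 * cos (pi / 12%:R)) * 4 ^+ 1 < 1 :> R.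
Proof.
have /andP[pl _] := tr12_bounds.
by apply: (@small_chord_of R 12 isT 1 (9 / 10)); lra.
Qed.

Lemma small_chord10 : (2 - 2 * cos (pi / 10%:R)) * 4 ^+ 1 < 1 :> R.
Proof.
have /andP[pl _] := tr10_bounds.
by apply: (@small_chord_of R 10 isT 1 (9 / 10)); lra.
Qed.

Lemma small_chord18 : (2 - 2 * cos (pi / 18%:R)) * 4 ^+ 2 < 1 :> R.
Proof.
have /andP[pl _] := tr18_bounds.
by apply: (@small_chord_of R 18 isT 2 (32 / 33)); lra.
Qed.

Lemma small_chord14 : (2 - 2 * cos (pi / 14%:R)) * 4 ^+ 2 < 1 :> R.
Proof.
have /andP[pl _] := tr14_bounds.
by apply: (@small_chord_of R 14 isT 2 (32 / 33)); lra.
Qed.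

End Bounds.

(* In the next lemmas N and N' (and N'') are the values of |c|^2 at the given
   place and at the conjugate ones, for an entry c of the first column. *)
Lemma no_small_column_2_12_12 (R : realFieldType) (p N N' : R) : 0 <= N -> 0 <= N' ->
    12 / 7 < p -> p < 7 / 4 -> p ^+ 2 = 3 ->
    1 <= N * N' -> 0 <= 1 + 2 * - p * (- p + 2) * N' ->
    (1 + 2 * (2 * p * (p + 2)) * N) ^+ 2 * ((2 - p) / 4) <= (2 + p) / 4 * (p + 2) ^+ 2 ->
  False.
Proof.
move=> N0 N'0 pl pu mp nn.
have -> : 2 * - p * (- p + 2) = 6 - 4 * p by ring: mp.
have -> : (p + 2) ^+ 2 = 7 + 4 * p by ring: mp.
have -> : 2 * p * (p + 2) = 6 + 4 * p by ring: mp.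
move=> c' h.
(* As b = m, the bound co^2 |s|^2 / si^2 is the square of |s|^2 = 1 + w, so the disc is 1 + 2 w N <=
   1 + w. *)
have Nle : N <= 1 / 2.
  rewrite leNgt; apply/negP => Ngt.
  have : 0 < (1 + 2 * (6 + 4 * p) * N - (7 + 4 * p)) * (1 + 2 * (6 + 4 * p) * N + (7 + 4 * p)) * (2 - p).
    clear -pl pu Ngt; by rewrite !mulr_gt0; nra.
  have : (7 + 4 * p) ^+ 2 * (2 - p) = (2 + p) * (7 + 4 * p) by ring: mp.
  clear -h; lra.
have : 0 <= (1 / 2 - N) * N' by rewrite mulr_ge0 ?subr_ge0.
have : 0 <= (p - 12 / 7) * N' by apply: mulr_ge0 N'0; rewrite subr_ge0 ltW.
clear -pl c' nn; lra.
Qed.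

(* Here the bounds allow norm 1 for N itself; the norm of N - 1 excludes it. *)
Lemma no_small_column_2_10_10 (R : realFieldType) (p N N' : R) : 0 <= N -> 0 <= N' ->
    8 / 5 < p -> p < 13 / 8 -> p ^+ 2 = p + 1 ->
    1 <= N * N' ->
    ((N - 1) ^+ 2 != 0 -> 1 <= (N - 1) ^+ 2 * (N' - 1) ^+ 2) ->
    0 <= 1 + 2 * (1 - p) ^+ 3 * N' ->
    (1 + 2 * (2 * p ^+ 3) * N) ^+ 2 * ((2 - p) / 4) <= (2 + p) / 4 * (p ^+ 2 * (2 + p)) ->
  False.
Proof.
move=> N0 N'0 pl pu mp nn n'.
have -> : 2 * (1 - p) ^+ 3 = 6 - 4 * p by ring: mp.
have -> : p ^+ 2 * (2 + p) = 4 * p + 3 by ring: mp.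
have -> : 2 * (2 * p ^+ 3) = 8 * p + 4 by ring: mp.
move=> c' h.
have Nle : N <= 1 / 2.
  rewrite leNgt; apply/negP => Ngt.
  have : 0 < (1 + (8 * p + 4) * N - (4 * p + 3)) * (1 + (8 * p + 4) * N + (4 * p + 3)) * (2 - p).
    clear -pl pu Ngt; by rewrite !mulr_gt0; nra.
  have : (4 * p + 3) ^+ 2 * (2 - p) = (2 + p) * (4 * p + 3) by ring: mp.
  clear -h; lra.
have N'le : N' <= 5 / 2.
  have : 0 <= (p - 8 / 5) * N' by apply: mulr_ge0 N'0; rewrite subr_ge0 ltW.
  clear -c'; lra.
have Nge : 2 / 5 <= N.
  have : 0 <= (5 / 2 - N') * N by rewrite mulr_ge0 ?subr_ge0.
  clear -nn; lra.
have N'ge : 2 <= N'.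
  have : 0 <= (1 / 2 - N) * N' by rewrite mulr_ge0 ?subr_ge0.
  clear -nn; lra.
have d0 : (N - 1) ^+ 2 != 0.
  by rewrite sqrf_eq0; apply/eqP; clear -Nle; lra.
move: (n' d0).
have a1 : (N - 1) ^+ 2 <= (3 / 5) ^+ 2 by clear -Nge Nle; nra.
have a2 : (N' - 1) ^+ 2 <= (3 / 2) ^+ 2 by clear -N'ge N'le; nra.
have : (N - 1) ^+ 2 * (N' - 1) ^+ 2 <= (3 / 5) ^+ 2 * (3 / 2) ^+ 2.
  by rewrite ler_pM ?sqr_ge0.
clear; lra.
Qed.

(** Definiteness at the two other places bounds N' and N'' by 2 and the disc bounds N by 1/5, so the
    norm is at most 4/5. *)
Lemma no_small_column_2_3_18 (R : realFieldType) (p N N' N'' W' W'' : R) :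
    0 <= N -> 0 <= N' -> 0 <= N'' ->
    15 / 8 < p -> p < 17 / 9 ->
    W' <= - (1 / 2) -> W'' <= - (1 / 2) ->
    1 <= N * (N' * N'') -> 0 <= 1 + W' * N' -> 0 <= 1 + W'' * N'' ->
    (1 + 2 * (p * (p + 2)) * N) ^+ 2 * (1 - (1 / 2) ^+ 2) <= (2 + p) / 4 * (p + 1) ^+ 2 ->
  False.
Proof.
move=> N0 N'0 N''0 pl pu W'le W''le nn c' c'' h.
have N'le : N' <= 2 by clear -W'le c' N'0; nra.
have N''le : N'' <= 2 by clear -W''le c'' N''0; nra.
have Nle : N <= 1 / 5.
  rewrite leNgt; apply/negP => Ngt; move: h.
  have w7 : 7 <= p * (p + 2) by clear -pl; nra.
  have L : 19 / 5 <= 1 + 2 * (p * (p + 2)) * N by clear -w7 Ngt; nra.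
  have : (19 / 5) ^+ 2 <= (1 + 2 * (p * (p + 2)) * N) ^+ 2 by clear -L; nra.
  have : (2 + p) * (p + 1) ^+ 2 <= 35 by clear -pl pu; nra.
  clear; lra.
have NN : N' * N'' <= 2 * 2 by rewrite ler_pM.
have : N * (N' * N'') <= 1 / 5 * (2 * 2) by rewrite ler_pM // mulr_ge0.
clear -nn; lra.
Qed.

(** The bounds are 1, 2 and 9/20, so the norm is at most 9/10. *)
Lemma no_small_column_2_3_14 (R : realFieldType) (p N N' N'' W' W'' : R) :
    0 <= N -> 0 <= N' -> 0 <= N'' ->
    9 / 5 < p -> p < 20 / 11 -> p ^+ 3 = p ^+ 2 + 2 * p - 1 ->
    W' <= - (1 / 2) -> W'' <= - (20 / 9) ->
    1 <= N * (N' * N'') -> 0 <= 1 + W' * N' -> 0 <= 1 + W'' * N'' ->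
    (1 + 2 * (p - 1) * N) ^+ 2 * (1 - (1 / 2) ^+ 2) <= (2 + p) / 4 * (p ^+ 2 - 1) ^+ 2 ->
  False.
Proof.
move=> N0 N'0 N''0 pl pu mp W'le W''le nn c' c'' h.
have N'le : N' <= 2 by clear -W'le c' N'0; nra.
have N''le : N'' <= 9 / 20 by clear -W''le c'' N''0; nra.
have Nle : N <= 1.
  rewrite leNgt; apply/negP => Ngt; move: h.
  have L : 13 / 5 <= 1 + 2 * (p - 1) * N by clear -pl Ngt; nra.
  have : (13 / 5) ^+ 2 <= (1 + 2 * (p - 1) * N) ^+ 2 by clear -L; nra.
  have : (2 + p) * (p ^+ 2 - 1) ^+ 2 <= 20.
    have -> : (2 + p) * (p ^+ 2 - 1) ^+ 2 = 4 * p ^+ 2 + 4 * p - 1 by ring: mp.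
    clear -pl pu; nra.
  clear; lra.
have NN : N' * N'' <= 2 * (9 / 20) by rewrite ler_pM.
have : N * (N' * N'') <= 1 * (2 * (9 / 20)) by rewrite ler_pM // mulr_ge0.
clear -nn; lra.
Qed.

(** The norm of N alone leaves 4/3 <= N <= 17/10 possible, but then N - 1 has conjugates of size at
    most 7/10 and 1, and norm below 1. *)
Lemma no_small_column_2_3_12 (R : realFieldType) (p N N' : R) : 0 <= N -> 0 <= N' ->
    12 / 7 < p -> p < 7 / 4 ->
    1 <= N * N' ->
    ((N - 1) ^+ 2 != 0 -> 1 <= (N - 1) ^+ 2 * (N' - 1) ^+ 2) ->
    0 <= 1 + (- p - 1) / 2 * N' ->
    (1 + 2 * ((p - 1) / 2) * N) ^+ 2 * (1 - (1 / 2) ^+ 2) <= (2 + p) / 4 * (2 + p) ->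
  False.
Proof.
move=> N0 N'0 pl pu nn n' c' h.
have N'le : N' <= 3 / 4.
  have : 0 <= (p - 12 / 7) * N' by apply: mulr_ge0 N'0; rewrite subr_ge0 ltW.
  clear -c'; lra.
have Nge : 4 / 3 <= N.
  have : 0 <= (3 / 4 - N') * N by rewrite mulr_ge0 ?subr_ge0.
  clear -nn; lra.
have Nle : N <= 17 / 10.
  rewrite leNgt; apply/negP => Ngt; move: h.
  have L : 11 / 5 <= 1 + 2 * ((p - 1) / 2) * N by clear -pl Ngt; nra.
  have : (11 / 5) ^+ 2 <= (1 + 2 * ((p - 1) / 2) * N) ^+ 2 by clear -L; nra.
  clear -pl pu; nra.
have d0 : (N - 1) ^+ 2 != 0.
  by rewrite sqrf_eq0; apply/eqP; clear -Nge; lra.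
move: (n' d0).
have a1 : (N - 1) ^+ 2 <= (7 / 10) ^+ 2 by clear -Nge Nle; nra.
have a2 : (N' - 1) ^+ 2 <= 1 by clear -N'0 N'le; nra.
have : (N - 1) ^+ 2 * (N' - 1) ^+ 2 <= (7 / 10) ^+ 2 * 1.
  by rewrite ler_pM ?sqr_ge0.
clear; lra.
Qed.

(** * The five groups *)

Section Cases.
Variable R : realType.
Local Notation P m := (trace_poly m).

Definition evE := (evD, evN, evM, evX, ev1, evn).

(** Presents |c|^2 - 1 as an element of Z[zeta], to which [norm_ge1] applies. *)
Lemma nsq_ev_sub1 m k F : (2 < m)%N ->
  nsq (ev R m k (F * star m F - 1)) = (nsq (ev R m k F) - 1) ^+ 2.
Proof.
move=> m2; have m0 : (0 < m)%N := ltn_trans (isT : 0 < 2)%N m2.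
by rewrite evB ev1 -nsq_ev // -nsq_real (realCD (nsq _)) realCN realC1.
Qed.

Lemma ev_zeta m : ev R m 1 'X = zeta R m.
Proof. by rewrite -['X]expr1 evXn. Qed.

Lemma zeta_conj m : zeta R m * conjc (zeta R m) = 1.
Proof. by rewrite -nsqE -[zeta R m]expr1 nsq_zetaX. Qed.

(** 1 + zeta has half the argument of zeta, so the phase eps belonging to s = x (1 + zeta) is
    zeta. *)
Lemma conj_real_zetaD1 m (x : R) :
  x%:C * (1 + zeta R m) = zeta R m * conjc (x%:C * (1 + zeta R m)).
Proof.
rewrite conjcM conjcD (conjc_real x) (conjc_real 1) realC1.
transitivity (x%:C * (zeta R m + zeta R m * conjc (zeta R m))); last by ring.
by rewrite zeta_conj addrC.
Qed.

Lemma conj_real (x : R) : x%:C = 1 * conjc x%:C.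
Proof. by rewrite conjc_real mul1r. Qed.

Lemma triangle_group_2_12_12 : triangle_group (Gamma 12 (2 * p1 R 12 * (p1 R 12 + 2))) 2 12 12.
Proof.
have /andP[pl pu] := tr12_bounds R; have mp := tr12 R; have t5 := tr12_5 R.
have s2 : sin (pi / 12%:R) ^+ 2 = (2 - tr R 12 1) / 4 :> R by have := @sin2_tr R 12; lra.
have c2 : cos (pi / 12%:R) ^+ 2 = (2 + tr R 12 1) / 4 :> R by have := @cos2_tr R 12; lra.
have pks : perm_eq [seq k <- iota 0 12 | coprime k 12]
  ((1%N :: [:: 5]) ++ map (subn 12) (1%N :: [:: 5])) by [].
have evP k := @ev_trace_poly R 12 isT k.
rewrite p1E //; set p := tr R 12 1 in pl pu mp t5 s2 c2 *.
have -> : 2 * p%:C * (p%:C + 2) = (2 * p * (p + 2))%:C by ring.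
pose W k := 2 * tr R 12 k * (tr R 12 k + 2).
(* The angles force |s|^2 = (2 + p) / (2 - p) = (p + 2)^2, by p^2 = 3; as |s|^2 - 1 = w, t = 1. *)
apply: (@triangle_criterion R 12 12 [:: 5] isT isT pks _ _ W 1
   (2 * P 12 * (P 12 + 2)) _ _ _ _ _ 1 (P 12 + 2) 1 (2 * P 12 * (P 12 + 2)) 1).
- exact: small_chord12.
- clear -pl; nra.
- by [].
- by rewrite !(evE, evP) -/p; ring.
- by move=> k _; rewrite !(evE, evP) /W; ring.
- by move=> k; rewrite inE => /eqP->; rewrite /W t5 -/p; clear -pl pu; nra.
- exact: ltr01.
- by rewrite ev1.
- by rewrite !(evE, evP) -/p; ring.
- rewrite !(evE, evP) -/p (_ : p%:C + 2 = (p + 2)%:C); [exact: conj_real | by ring].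
- rewrite !(evE, evP) -/p (_ : p%:C + 2 = (p + 2)%:C); last by ring.
  rewrite nsq_real; ring: mp.
- rewrite !(evE, evP) -/p (_ : p%:C + 2 = (p + 2)%:C); last by ring.
  by rewrite nsq_real s2 c2; field: mp.
move=> F F0 /(_ 5 (mem_head _ _)); have := norm_ge1 (m := 12) isT pks F0.
rewrite big_seq1.
have := nsq_ge0 (ev R 12 1 F); have := nsq_ge0 (ev R 12 5 F).
rewrite !(evE, evP) -/p (_ : p%:C + 2 = (p + 2)%:C); last by ring.
rewrite nsq_real /W t5 s2 c2 -/p => n5 n1 nn c5 h.
exact: no_small_column_2_12_12 n1 n5 pl pu mp nn c5 h.
Qed.

Lemma triangle_group_2_10_10 : triangle_group (Gamma 10 (2 * p1 R 10 ^+ 3)) 2 10 10.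
Proof.
have /andP[pl pu] := tr10_bounds R; have mp := tr10 R; have t3 := tr10_3 R.
have s2 : sin (pi / 10%:R) ^+ 2 = (2 - tr R 10 1) / 4 :> R by have := @sin2_tr R 10; lra.
have c2 : cos (pi / 10%:R) ^+ 2 = (2 + tr R 10 1) / 4 :> R by have := @cos2_tr R 10; lra.
have pks : perm_eq [seq k <- iota 0 10 | coprime k 10]
  ((1%N :: [:: 3]) ++ map (subn 10) (1%N :: [:: 3])) by [].
have evP k := @ev_trace_poly R 10 isT k.
have nz := nsq_zetaD1 R 10.
rewrite p1E //; set p := tr R 10 1 in pl pu mp t3 s2 c2 nz *.
have -> : 2 * p%:C ^+ 3 = (2 * p ^+ 3)%:C by ring.
pose W k := 2 * tr R 10 k ^+ 3.
have p3 : p ^+ 3 = 2 * p + 1 by ring: mp.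
(* Here |s|^2 = p^2 (2 + p) has norm 5 from Q(p) to Q, so it is not the square of a real element of
   Z[zeta]; 2 + p = |1 + zeta|^2 supplies a non-real s with eps = zeta. *)
apply: (@triangle_criterion R 10 10 [:: 3] isT isT pks _ _ W 1
   (2 * P 10 ^+ 3) _ _ _ _ _ 1 (P 10 * (1 + 'X)) 1 (2 * P 10 ^+ 3 * 'X) 'X).
- exact: small_chord10.
- by rewrite p3; clear -pl; lra.
- by [].
- by rewrite !(evE, evP) -/p; ring.
- by move=> k _; rewrite !(evE, evP) /W; ring.
- move=> k; rewrite inE => /eqP->; rewrite /W t3.
  have -> : 2 * (1 - p) ^+ 3 = 2 * (3 - 2 * p) by ring: mp.
  by clear -pl; lra.
- exact: ltr01.
- by rewrite ev1.
- by rewrite !(evE, evP) ev_zeta -/p; ring.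
- by rewrite !(evE, evP) ev_zeta -/p; exact: conj_real_zetaD1.
- rewrite !(evE, evP) ev_zeta -/p nsqM nsq_real nz; ring: mp.
- by rewrite !(evE, evP) ev_zeta -/p nsqM nsq_real nz s2 c2; field: mp.
move=> F F0 /(_ 3 (mem_head _ _)); have := norm_ge1 (m := 10) isT pks F0.
have : (nsq (ev R 10 1 F) - 1) ^+ 2 != 0 ->
    1 <= (nsq (ev R 10 1 F) - 1) ^+ 2 * (nsq (ev R 10 3 F) - 1) ^+ 2.
  rewrite -!(nsq_ev_sub1 (m := 10) _ F isT) nsq_eq0.
  by move=> /(norm_ge1 (m := 10) isT pks); rewrite big_seq1.
rewrite big_seq1.
have := nsq_ge0 (ev R 10 1 F); have := nsq_ge0 (ev R 10 3 F).
rewrite !(evE, evP) ev_zeta -/p nsqM nsq_real nz /W t3 s2 c2 -/p => n3 n1 n' nn c3 h.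
exact: no_small_column_2_10_10 n1 n3 pl pu mp nn n' c3 h.
Qed.

Lemma triangle_group_2_3_18 : triangle_group (Gamma 18 (p1 R 18 * (p1 R 18 + 2))) 2 3 18.
Proof.
have /andP[pl pu] := tr18_bounds R; have mp := tr18 R.
have t5 := tr18_5 R; have t7 := tr18_7 R.
have s2 : sin (pi / 18%:R) ^+ 2 = (2 - tr R 18 1) / 4 :> R by have := @sin2_tr R 18; lra.
have c2 : cos (pi / 18%:R) ^+ 2 = (2 + tr R 18 1) / 4 :> R by have := @cos2_tr R 18; lra.
have cb2 := cos_pi3 R.
have pks : perm_eq [seq k <- iota 0 18 | coprime k 18]
  ((1%N :: [:: 5; 7]) ++ map (subn 18) (1%N :: [:: 5; 7])) by [].
have evP k := @ev_trace_poly R 18 isT k.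
rewrite p1E //; set p := tr R 18 1 in pl pu mp t5 t7 s2 c2 *.
have -> : p%:C * (p%:C + 2) = (p * (p + 2))%:C by ring.
pose W k := tr R 18 k * (tr R 18 k + 2).
have W5 : W 5 <= - (1 / 2).
  have [u1 u2] : - (2 / 5) <= tr R 18 5 /\ tr R 18 5 <= - (3 / 10).
    by rewrite t5 -/p; clear -pl pu; split; nra.
  by rewrite /W; clear -u1 u2; nra.
have W7 : W 7 <= - (1 / 2).
  have [u1 u2] : - (8 / 5) <= tr R 18 7 /\ tr R 18 7 <= - (3 / 2).
    by rewrite t7 -/p; clear -pl pu; split; nra.
  by rewrite /W; clear -u1 u2; nra.
(* |s|^2 = 1 / (2 - p) = (p + 1)^2 by the minimal polynomial, and |s|^2 - 1 = w gives t = 1. *)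
apply: (@triangle_criterion R 18 3 [:: 5; 7] isT isT pks _ _ W 1
   (P 18 * (P 18 + 2)) _ _ _ _ _ 1 (P 18 + 1) 1 (P 18 * (P 18 + 2)) 1).
- exact: small_chord18.
- clear -pl; nra.
- by [].
- by rewrite !(evE, evP) -/p; ring.
- by move=> k _; rewrite !(evE, evP) /W; ring.
- by move=> k; rewrite !inE => /orP[] /eqP->; [clear -W5 | clear -W7]; lra.
- exact: ltr01.
- by rewrite ev1.
- by rewrite !(evE, evP) -/p; ring.
- rewrite !(evE, evP) -/p (_ : p%:C + 1 = (p + 1)%:C); [exact: conj_real | by ring].
- rewrite !(evE, evP) -/p (_ : p%:C + 1 = (p + 1)%:C); last by ring.
  rewrite nsq_real; ring: mp.
- rewrite !(evE, evP) -/p (_ : p%:C + 1 = (p + 1)%:C); last by ring.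
  by rewrite nsq_real s2 cb2; field: mp.
move=> F F0 H; have := norm_ge1 (m := 18) isT pks F0.
have := H 5 (mem_head _ _); have := H 7 (mem_last 5 [:: 7]).
rewrite big_cons big_seq1.
have := nsq_ge0 (ev R 18 1 F); have := nsq_ge0 (ev R 18 5 F).
have := nsq_ge0 (ev R 18 7 F).
rewrite !(evE, evP) -/p (_ : p%:C + 1 = (p + 1)%:C); last by ring.
rewrite nsq_real sin2cos2 cb2 c2 => n7 n5 n1 c7 c5 nn h.
exact: no_small_column_2_3_18 n1 n5 n7 pl pu W5 W7 nn c5 c7 h.
Qed.

Lemma triangle_group_2_3_14 : triangle_group (Gamma 14 (- p5 R 14)^-1) 2 3 14.
Proof.
have /andP[pl pu] := tr14_bounds R; have mp := tr14 R.
have t3 := tr14_3 R; have t5 := tr14_5 R.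
have s2 : sin (pi / 14%:R) ^+ 2 = (2 - tr R 14 1) / 4 :> R by have := @sin2_tr R 14; lra.
have c2 : cos (pi / 14%:R) ^+ 2 = (2 + tr R 14 1) / 4 :> R by have := @cos2_tr R 14; lra.
have cb2 := cos_pi3 R.
have pks : perm_eq [seq k <- iota 0 14 | coprime k 14]
  ((1%N :: [:: 3; 5]) ++ map (subn 14) (1%N :: [:: 3; 5])) by [].
have evP k := @ev_trace_poly R 14 isT k.
rewrite p5E // t5; set p := tr R 14 1 in pl pu mp t3 t5 s2 c2 *.
have -> : (- (2 - p ^+ 2)%:C)^-1 = (p - 1)%:C.
  have pp : (p ^+ 2 - 2) * (p - 1) = 1 by ring: mp.
  rewrite -realCN opprB -fmorphV /=; congr (_ %:C).
  have q0 : p ^+ 2 - 2 != 0 by apply: contra_eq_neq pp => ->; rewrite mul0r eq_sym oner_neq0.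
  by apply: (mulfI q0); rewrite pp divff.
pose W k := tr R 14 k - 1.
have W3 : W 3 <= - (1 / 2) by rewrite /W t3 -/p; clear -pl pu; nra.
have W5 : W 5 <= - (20 / 9) by rewrite /W t5 -/p; clear -pl pu; nra.
have t0 : 0 < p ^+ 2 - 1 by clear -pl; nra.
(* |s|^2 = 1 / (2 - p) = (p^2 - 1)^2; since 1 - w = 2 - p, the equation |s|^2 = 1 + w t^2 is solved
   by t = s. *)
apply: (@triangle_criterion R 14 3 [:: 3; 5] isT isT pks _ _ W 1
   (P 14 - 1) _ _ _ _ _ (p ^+ 2 - 1) (P 14 ^+ 2 - 1) (P 14 ^+ 2 - 1)
   ((P 14 - 1) * (P 14 ^+ 2 - 1)) 1).
- exact: small_chord14.
- clear -pl; lra.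
- by [].
- by rewrite !(evE, evP) -/p; ring.
- by move=> k _; rewrite !(evE, evP) /W; ring.
- by move=> k; rewrite !inE => /orP[] /eqP->; [clear -W3 | clear -W5]; lra.
- exact: t0.
- by rewrite !(evE, evP) -/p; ring.
- by rewrite !(evE, evP) -/p; ring.
- rewrite !(evE, evP) -/p (_ : p%:C ^+ 2 - 1 = (p ^+ 2 - 1)%:C); [exact: conj_real | by ring].
- rewrite !(evE, evP) -/p (_ : p%:C ^+ 2 - 1 = (p ^+ 2 - 1)%:C); last by ring.
  rewrite nsq_real; ring: mp.
- rewrite !(evE, evP) -/p (_ : p%:C ^+ 2 - 1 = (p ^+ 2 - 1)%:C); last by ring.
  by rewrite nsq_real s2 cb2; field: mp.
move=> F F0 H; have := norm_ge1 (m := 14) isT pks F0.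
have := H 3 (mem_head _ _); have := H 5 (mem_last 3 [:: 5]).
rewrite big_cons big_seq1.
have := nsq_ge0 (ev R 14 1 F); have := nsq_ge0 (ev R 14 3 F).
have := nsq_ge0 (ev R 14 5 F).
rewrite !(evE, evP) -/p (_ : p%:C ^+ 2 - 1 = (p ^+ 2 - 1)%:C); last by ring.
rewrite nsq_real sin2cos2 cb2 c2 => n5 n3 n1 c5 c3 nn h.
exact: no_small_column_2_3_14 n1 n3 n5 pl pu mp W3 W5 nn c3 c5 h.
Qed.

Lemma triangle_group_2_3_12 : triangle_group (Gamma 12 (p1 R 12 + 1)^-1) 2 3 12.
Proof.
have /andP[pl pu] := tr12_bounds R; have mp := tr12 R; have t5 := tr12_5 R.
have s2 : sin (pi / 12%:R) ^+ 2 = (2 - tr R 12 1) / 4 :> R by have := @sin2_tr R 12; lra.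
have c2 : cos (pi / 12%:R) ^+ 2 = (2 + tr R 12 1) / 4 :> R by have := @cos2_tr R 12; lra.
have cb2 := cos_pi3 R.
have pks : perm_eq [seq k <- iota 0 12 | coprime k 12]
  ((1%N :: [:: 5]) ++ map (subn 12) (1%N :: [:: 5])) by [].
have evP k := @ev_trace_poly R 12 isT k.
have nz := nsq_zetaD1 R 12.
rewrite p1E //; set p := tr R 12 1 in pl pu mp t5 s2 c2 nz *.
have -> : (p%:C + 1)^-1 = ((p - 1) / 2)%:C.
  have pp : (p + 1) * ((p - 1) / 2) = 1 by field: mp.
  rewrite -realC1 -realCD -fmorphV /=; congr (_ %:C).
  have q0 : p + 1 != 0 by apply: contra_eq_neq pp => ->; rewrite mul0r eq_sym oner_neq0.
  by apply: (mulfI q0); rewrite pp divff.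
pose W k := (tr R 12 k - 1) / 2.
(* w = (p - 1) / 2 is not integral, hence [v] = 2; t = p + 1 gives w t = 1, so S is integral. |s|^2
   = 1 / (2 - p) = 2 + p = |1 + zeta|^2. *)
apply: (@triangle_criterion R 12 3 [:: 5] isT isT pks _ _ W 2
   (P 12 - 1) _ _ _ _ _ (p + 1) (1 + 'X) (P 12 + 1) 'X 'X).
- exact: small_chord12.
- clear -pl; lra.
- by [].
- by rewrite !(evE, evP) -/p (_ : 2 * _ = p - 1) ?realCD ?realCN //; field.
- by move=> k _; rewrite !(evE, evP) (_ : 2 * _ = tr R 12 k - 1) ?realCD ?realCN // /W; field.
- by move=> k; rewrite inE => /eqP->; rewrite /W t5 -/p; clear -pl; lra.
- clear -pl; lra.
- by rewrite !(evE, evP) -/p realCD.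
- have wt : (p - 1) / 2 * (p + 1) = 1 by field: mp.
  by rewrite ev_zeta -realCM wt realC1 mul1r.
- by rewrite !(evE, evP) ev_zeta -[1 + _]mul1r -realC1; exact: conj_real_zetaD1.
- by rewrite !(evE, evP) ev_zeta nz; field: mp.
- by rewrite !(evE, evP) ev_zeta nz s2 cb2; field: mp.
move=> F F0 /(_ 5 (mem_head _ _)); have := norm_ge1 (m := 12) isT pks F0.
have : (nsq (ev R 12 1 F) - 1) ^+ 2 != 0 ->
    1 <= (nsq (ev R 12 1 F) - 1) ^+ 2 * (nsq (ev R 12 5 F) - 1) ^+ 2.
  rewrite -!(nsq_ev_sub1 (m := 12) _ F isT) nsq_eq0.
  by move=> /(norm_ge1 (m := 12) isT pks); rewrite big_seq1.
rewrite big_seq1.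
have := nsq_ge0 (ev R 12 1 F); have := nsq_ge0 (ev R 12 5 F).
rewrite !(evE, evP) ev_zeta nz /W t5 sin2cos2 cb2 c2 -/p => n5 n1 n' nn c5 h.
exact: no_small_column_2_3_12 n1 n5 pl pu nn n' c5 h.
Qed.

End Cases.

Local Close Scope complex_scope.

Theorem theorem3p6 (R : realType) :
  [/\ triangle_group (Gamma 12 (2 * p1 R 12 * (p1 R 12 + 2))) 2 12 12,
      triangle_group (Gamma 10 (2 * p1 R 10 ^+ 3)) 2 10 10,
      triangle_group (Gamma 18 (p1 R 18 * (p1 R 18 + 2))) 2 3 18,
      triangle_group (Gamma 14 (- p5 R 14)^-1) 2 3 14
    & triangle_group (Gamma 12 (p1 R 12 + 1)^-1) 2 3 12].
Proof.
split; [exact: triangle_group_2_12_12 | exact: triangle_group_2_10_10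
  | exact: triangle_group_2_3_18 | exact: triangle_group_2_3_14
  | exact: triangle_group_2_3_12].
Qed.
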